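(* Let $a\in\mathbb{Z}$ and $p\ge1$, and suppose that either $a\ge1$ and $p=1$, or $a\ge2$ and $p>1$. Let $T:\ell^p(\mathbb{Z},\omega_a)\to\ell^p(\mathbb{Z},\omega_a)$ be an algebra isomorphism. Then $T$ can be extended to a continuous operator on $\ell^p(\mathbb{Z})$, and this extension is a linear isomorphism of $\ell^p(\mathbb{Z})$.
   Context: For $a\ge0$, $\omega_a(n)=\max(1,|n|^a)$, $n\in\mathbb{Z}$. $\ell^p(\mathbb{Z},\omega_a)$ is the space of sequences $f=(f_n)_{n\in\mathbb{Z}}$ with $\sum_n|f_n|^p\omega_a(n)^p<\infty$, normed by $\left(\sum_n|f_n|^p\omega_a(n)^p\right)^{1/p}$; under the given hypotheses it is an algebra under convolution, and $\ell^p(\mathbb{Z},\omega_a)\subset\ell^p(\mathbb{Z})$. *)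

(* Defs.v *)
From HB Require Import structures.
From mathcomp Require Import all_boot all_order all_algebra.
From mathcomp Require Import all_classical all_reals all_analysis.
From mathcomp Require Import complex.
Set Implicit Arguments. Unset Strict Implicit. Unset Printing Implicit Defensive.
Import Order.TTheory GRing.Theory Num.Theory.
Import numFieldNormedType.Exports.
Local Open Scope ring_scope.
Local Open Scope classical_set_scope.

Definition cmod {R : realType} (z : R[i]) : R := ComplexField.Normc.normc z.

Definition omega {R : realType} (a : R) (n : int) : R :=
  Num.max 1 ((`|n|%:~R : R) `^ a).

Definition lpw_sum {R : realType} (p a : R) (f : int -> R[i]) : \bar R :=
  \esum_(n in [set: int]) ((cmod (f n) * omega a n) `^ p)%:E.

Definition in_lpw {R : realType} (p a : R) (f : int -> R[i]) : Prop :=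
  (lpw_sum p a f < +oo)%E.

Definition lp_sum {R : realType} (p : R) (f : int -> R[i]) : \bar R :=
  \esum_(n in [set: int]) ((cmod (f n)) `^ p)%:E.

Definition in_lp {R : realType} (p : R) (f : int -> R[i]) : Prop :=
  (lp_sum p f < +oo)%E.

(* the l^p(Z) norm (meaningful when in_lp p f) *)
Definition lp_norm {R : realType} (p : R) (f : int -> R[i]) : R :=
  (fine (lp_sum p f)) `^ (p^-1).

Definition zpsum {R : realType} (u : int -> R[i]) (N : nat) : R[i] :=
  \sum_(k < (N + N).+1) u (k%:Z - N%:Z).

Definition zsum {R : realType} (u : int -> R[i]) : R[i] :=
  Complex (limn (fun N => (complex.Re (zpsum u N) : R)))
          (limn (fun N => (complex.Im (zpsum u N) : R))).

Definition conv {R : realType} (f g : int -> R[i]) : int -> R[i] :=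
  fun n => zsum (fun k => f k * g (n - k)).

Definition alg_iso_lpw {R : realType} (p a : R)
    (T : (int -> R[i]) -> (int -> R[i])) : Prop :=
  [/\ (forall f, in_lpw p a f -> in_lpw p a (T f)),
      (forall (c : R[i]) f g, in_lpw p a f -> in_lpw p a g ->
         T (fun n => c * f n + g n) = (fun n => c * T f n + T g n)),
      (forall f g, in_lpw p a f -> in_lpw p a g ->
         T (conv f g) = conv (T f) (T g)),
      (forall f g, in_lpw p a f -> in_lpw p a g -> T f = T g -> f = g) &
      (forall h, in_lpw p a h -> exists2 f, in_lpw p a f & T f = h)].

Definition lin_iso_lp {R : realType} (p : R)
    (S : (int -> R[i]) -> (int -> R[i])) : Prop :=
  [/\ (forall f, in_lp p f -> in_lp p (S f)),
      (forall (c : R[i]) f g, in_lp p f -> in_lp p g ->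
         S (fun n => c * f n + g n) = (fun n => c * S f n + S g n)),
      (exists C : R, forall f, in_lp p f -> lp_norm p (S f) <= C * lp_norm p f),
      (forall f g, in_lp p f -> in_lp p g -> S f = S g -> f = g) &
      (forall h, in_lp p h -> exists2 f, in_lp p f & S f = h) /\
      (exists C : R, forall f, in_lp p f -> lp_norm p f <= C * lp_norm p (S f))].

(* Main.v *)
From Pilot Require Import Defs.
From HB Require Import structures.
From mathcomp Require Import all_boot all_order all_algebra.
From mathcomp Require Import all_classical all_reals all_analysis.
From mathcomp Require Import complex.
From mathcomp Require Import ring lra zify.
Set Implicit Arguments. Unset Strict Implicit. Unset Printing Implicit Defensive.
Import Order.TTheory GRing.Theory Num.Theory.
Import numFieldNormedType.Exports Pilot.Defs.
Local Open Scope ring_scope.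

(** Write [D] for the derivation [(D f)_n = n f_n], [e_n] for the unit masses and
    [chi_z f = \sum_n f_n z^n] for [|z| = 1]; the [chi_z] are multiplicative and
    determine the coefficients.

    [T] is bounded on [A = l^p(Z, omega_a)]: the characters [chi_z o T] are
    bounded, hence so are the coefficients of [T f], and Baire's argument applies.

    For finitely supported [g], [chi_z (D (T g)) = c_z chi_z (T (D g))] with [c_z]
    independent of [g] (chain rule), whence [T (D f) * D (T g) = D (T f) * T (D g)].
    Let [psi] be such that [T psi = e_1] and [psi_N] its truncations: then
    [D (T psi_N)] tends to [e_1] in [l^p(Z, omega_(a-1))].  If [T] is bounded on
    finitely supported sequences for the weight [omega_(j+1)], let [f] be finitely
    supported with [f_0 = 0] and take [g] with [f = D g]; then
    [e_1 * T f = T (D psi_N) * D (T g) + r_N * T f] with [r_N] small, and absorbing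
    the last term bounds [T] for the weight [omega_j].  After [a] steps [T] is
    bounded for the norm of [l^p(Z)] and extends by density; so does its inverse. *)

(** The hypotheses on a and p serve to place l^p(Z, omega_(a-1)) inside l^1(Z): D (T f) then still
    has characters, although D costs one power of the weight. Below, [k] stands for a - 1. The
    difficulty is that T is controlled only for the norm of A, and a weaker norm of f says nothing
    about T f directly. The exchange formula moves D from one factor to the other, so that a bound
    of T at weight j + 1, applied to an antiderivative of f, can be read at weight j. If D psi were
    in A, it would give e_1 * T (D g) = T (D psi) * D (T g) at once, as D e_1 = e_1; but D psi has
    lost one power of the weight, and T (D psi) need not make sense. Truncating psi repairs this at
    the price of the error r_N, whose norm only has to lie below a constant known in advance; N then
    stays the same for all f, and so does T (D psi_N). Absorbing is legitimate because T f is known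
    to have finite norm. *)

Section ComplexModulus.
Variable R : realType.
Implicit Types (x y z : R[i]) (t : R).

Lemma cmod_ge0 z : 0 <= cmod z.
Proof. by case: z => a b; rewrite /cmod /= sqrtr_ge0. Qed.

Lemma cmod0 : cmod (0 : R[i]) = 0.
Proof. exact: ComplexField.Normc.normc0. Qed.

Lemma cmod1 : cmod (1 : R[i]) = 1.
Proof. exact: ComplexField.Normc.normc1. Qed.

Lemma cmod_eq0 z : cmod z = 0 -> z = 0.
Proof. exact: ComplexField.Normc.eq0_normc. Qed.

Lemma cmodM x y : cmod (x * y) = cmod x * cmod y.
Proof. exact: ComplexField.Normc.normcM. Qed.

Lemma cmodV z : cmod z^-1 = (cmod z)^-1.
Proof. exact: ComplexField.Normc.normcV. Qed.

Lemma cmodD x y : cmod (x + y) <= cmod x + cmod y.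
Proof. exact: le_normcD. Qed.

Lemma cmodN z : cmod (- z) = cmod z.
Proof. exact: normcN. Qed.

Lemma cmodB x y : cmod (x - y) <= cmod x + cmod y.
Proof. by apply: le_trans (cmodD _ _) _; rewrite cmodN. Qed.

Lemma cmodBC x y : cmod (x - y) = cmod (y - x).
Proof. by rewrite -cmodN opprB. Qed.

Lemma cmod_real t : cmod t%:C%C = `|t|.
Proof. by rewrite /cmod /= expr0n addr0 sqrtr_sqr. Qed.

Lemma real_complex_int (n : int) : ((n%:~R : R)%:C%C) = n%:~R :> R[i].
Proof. exact: rmorph_int. Qed.

Lemma cmod_int (n : int) : cmod (n%:~R : R[i]) = `|n|%:~R.
Proof. by rewrite -real_complex_int cmod_real intr_norm. Qed.

Lemma cmod_Re z : `|complex.Re z| <= cmod z.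
Proof.
by case: z => a b /=; rewrite /cmod /= -sqrtr_sqr ler_wsqrtr// lerDl sqr_ge0.
Qed.

Lemma cmod_Im z : `|complex.Im z| <= cmod z.
Proof.
by case: z => a b /=; rewrite /cmod /= -sqrtr_sqr ler_wsqrtr// lerDr sqr_ge0.
Qed.

Lemma cmod_sum_le (I : Type) (l : seq I) (F : I -> R[i]) :
  cmod (\sum_(i <- l) F i) <= \sum_(i <- l) cmod (F i).
Proof.
elim: l => [|i l IH]; first by rewrite !big_nil cmod0.
by rewrite !big_cons (le_trans (cmodD _ _))// lerD2l.
Qed.

Lemma cmod_le_parts z : cmod z <= `|complex.Re z| + `|complex.Im z|.
Proof.
have cI : cmod ('i%C : R[i]) = 1.
  by rewrite /cmod /= expr0n expr1n add0r sqrtr1.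
case: z => a b; rewrite [X in cmod X]complexE (le_trans (cmodD _ _))//.
by rewrite cmodM cI mul1r !cmod_real.
Qed.

End ComplexModulus.

(** * Limits of complex sequences by explicit estimates *)

Section Convergence.
Variable R : realType.

(** Distances are measured with [cmod], since all norms below take values in [R], whereas the norm
    of [R[i]] takes values in [R[i]]. *)
Definition ccvg (u : nat -> R[i]) (l : R[i]) :=
  forall e : R, 0 < e -> exists N, forall n, (N <= n)%N -> cmod (u n - l) <= e.

Definition rcvg (u : nat -> R) (l : R) :=
  forall e : R, 0 < e -> exists N, forall n, (N <= n)%N -> `|u n - l| <= e.

Lemma rcvg_cvg u l : rcvg u l -> (u @ \oo --> l)%classic.
Proof.
move=> h; apply/cvgrPdist_le => e e0; have [N hN] := h _ e0.
by exists N => // n /= Nn; rewrite distrC hN.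
Qed.

Lemma cvg_rcvg u l : (u @ \oo --> l)%classic -> rcvg u l.
Proof.
move/cvgrPdist_le => h e e0; have [N _ hN] := h _ e0.
by exists N => n Nn; rewrite distrC; apply: hN.
Qed.

Lemma real_cauchy (u : nat -> R) :
  (forall e, 0 < e -> exists N, forall m n, (N <= m)%N -> (N <= n)%N ->
     `|u m - u n| <= e) -> exists l, rcvg u l.
Proof.
move=> h; have : cvg (u @ \oo)%classic.
  apply/cauchy_cvgP/cauchy_exP => e e0.
  have [N hN] := h _ (divr_gt0 e0 (ltr0Sn _ 1)).
  exists (u N); exists N => // n /= Nn.
  rewrite /ball /= (le_lt_trans (hN _ _ (leqnn N) Nn))//.
  by rewrite ltr_pdivrMr// mulr_natr mulr2n ltrDl.
by move=> c; exists (limn u); apply: cvg_rcvg.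
Qed.

Lemma ccvg_Re u l : ccvg u l -> rcvg (fun n => complex.Re (u n)) (complex.Re l).
Proof.
move=> h e /h[N hN]; exists N => n Nn; apply: le_trans (hN _ Nn).
by rewrite -raddfB cmod_Re.
Qed.

Lemma ccvg_Im u l : ccvg u l -> rcvg (fun n => complex.Im (u n)) (complex.Im l).
Proof.
move=> h e /h[N hN]; exists N => n Nn; apply: le_trans (hN _ Nn).
by rewrite -raddfB cmod_Im.
Qed.

Lemma ccvg_cauchy (u : nat -> R[i]) :
  (forall e, 0 < e -> exists N, forall m n, (N <= m)%N -> (N <= n)%N ->
     cmod (u m - u n) <= e) -> exists l, ccvg u l.
Proof.
move=> h.
have [e e0|a ha] := @real_cauchy (fun n => complex.Re (u n)).
  have [N hN] := h _ e0; exists N => m n Nm Nn; apply: le_trans (hN _ _ Nm Nn).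
  by rewrite -raddfB cmod_Re.
have [e e0|b hb] := @real_cauchy (fun n => complex.Im (u n)).
  have [N hN] := h _ e0; exists N => m n Nm Nn; apply: le_trans (hN _ _ Nm Nn).
  by rewrite -raddfB cmod_Im.
exists (Complex a b) => e e0.
have e2 : 0 < e / 2 by rewrite divr_gt0.
have [N1 h1] := ha _ e2; have [N2 h2] := hb _ e2.
exists (maxn N1 N2) => n; rewrite geq_max => /andP[n1 n2].
rewrite (le_trans (cmod_le_parts _))// (splitr e) lerD//.
  by move: (h1 _ n1); rewrite raddfB.
by move: (h2 _ n2); rewrite raddfB.
Qed.

Lemma ccvg_unique u l l' : ccvg u l -> ccvg u l' -> l = l'.
Proof.
move=> h h'; apply/eqP; rewrite -subr_eq0; apply/eqP/cmod_eq0/eqP.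
rewrite eq_le cmod_ge0 andbT; apply/ler_addgt0Pr => e e0; rewrite add0r.
have e2 : 0 < e / 2 by rewrite divr_gt0.
have [N1 h1] := h _ e2; have [N2 h2] := h' _ e2.
have := h1 _ (leq_maxl N1 N2); have := h2 _ (leq_maxr N1 N2).
set x := u _ => a b.
have -> : l - l' = (x - l') - (x - l) by ring.
by rewrite (le_trans (cmodB _ _))// (splitr e) lerD.
Qed.

Lemma ccvgD u v l l' (c : R[i]) : ccvg u l -> ccvg v l' ->
  ccvg (fun n => c * u n + v n) (c * l + l').
Proof.
move=> h h' e e0.
have c0 : 0 < cmod c + 1 by rewrite ltr_pwDr ?cmod_ge0.
have e2 : 0 < e / 2 by rewrite divr_gt0.
have [N1 h1] := h _ (divr_gt0 e2 c0); have [N2 h2] := h' _ e2.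
exists (maxn N1 N2) => n; rewrite geq_max => /andP[n1 n2].
have -> : c * u n + v n - (c * l + l') = c * (u n - l) + (v n - l') by ring.
rewrite (le_trans (cmodD _ _))// (splitr e) lerD ?h2// cmodM.
apply: le_trans (_ : (cmod c + 1) * (e / 2 / (cmod c + 1)) <= _); last first.
  by rewrite mulrC divfK// gt_eqF.
by rewrite ler_pM ?cmod_ge0 ?h1// lerDl.
Qed.

End Convergence.

(** As lists, the windows turn the partial sums [zpsum] into sums over duplicate-free lists, the
    form in which all norms are stated. *)
Definition win (N : nat) : seq int := [seq k%:Z - N%:Z | k <- iota 0 (N + N).+1].

Lemma win_uniq N : uniq (win N).
Proof. by rewrite map_inj_uniq ?iota_uniq// => i j; lia. Qed.

Lemma mem_win n N : (n \in win N) = (`|n| <= N)%N.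
Proof.
apply/mapP/idP => [[k]|nN]; first by rewrite mem_iota => ? ->; lia.
by exists (absz (n + N%:Z)); rewrite ?mem_iota; lia.
Qed.

Lemma sub_win (l : seq int) : exists N, forall M, (N <= M)%N -> {subset l <= win M}.
Proof.
exists (\max_(n <- l) `|n|)%N => M NM n nl; rewrite mem_win (leq_trans _ NM)//.
by rewrite (big_rem n)//= leq_maxl.
Qed.

Lemma big_win (V : zmodType) (u : int -> V) N :
  \sum_(n <- win N) u n = \sum_(k < (N + N).+1) u (k%:Z - N%:Z).
Proof. by rewrite big_map -[X in iota 0 X]subn0 -/(index_iota 0 _) big_mkord. Qed.

Lemma zpsum_win (R : realType) (u : int -> R[i]) N :
  zpsum u N = \sum_(n <- win N) u n.
Proof. by rewrite big_win. Qed.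

Lemma big_winS (V : zmodType) (u : int -> V) N :
  \sum_(n <- win N.+1) u n = u (- N.+1%:Z) + \sum_(n <- win N) u n + u N.+1%:Z.
Proof.
rewrite !big_win addSn addnS big_ord_recl big_ord_recr /= addrA.
congr (_ + _ + _).
- by congr u; lia.
- by apply: eq_bigr => k _; congr u; rewrite /bump /=; lia.
- by congr u; rewrite /bump /=; lia.
Qed.

Lemma ler_sum_sub (R : realType) (F : int -> R) (l l' : seq int) :
  (forall n, 0 <= F n) -> uniq l -> {subset l <= l'} ->
  \sum_(n <- l) F n <= \sum_(n <- l') F n.
Proof.
move=> F0; elim: l l' => [|n l IH] l' /=; first by rewrite big_nil sumr_ge0.
move=> /andP[nl ul] sll'.
rewrite big_cons [leRHS](big_rem n) ?sll' ?mem_head//= lerD2l IH// => m ml.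
have mn : m != n by apply: contraNneq nl => <-.
have : m \in l' by rewrite sll'// inE ml orbT.
by rewrite (perm_mem (perm_to_rem (sll' _ (mem_head _ _)))) inE (negPf mn).
Qed.

(** * Minkowski's inequality on finite sets of indices *)

Section FiniteMinkowski.
Variables (R : realType) (p : R).
Hypothesis p_ge1 : 1 <= p.

Let p_gt0 : 0 < p. Proof. exact: lt_le_trans ltr01 p_ge1. Qed.
Let p_neq0 : p != 0. Proof. exact: lt0r_neq0. Qed.

Lemma powRK (x : R) : 0 <= x -> (x `^ p) `^ p^-1 = x.
Proof. by move=> x0; rewrite -powRrM divff// powRr1. Qed.

Lemma powRVK (x : R) : 0 <= x -> (x `^ p^-1) `^ p = x.
Proof. by move=> x0; rewrite -powRrM mulVf// powRr1. Qed.

Lemma powRV_le (x s : R) : 0 <= x -> 0 <= s -> (x `^ p^-1 <= s) = (x <= s `^ p).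
Proof.
move=> x0 s0; apply/idP/idP => h.
  by rewrite -(powRVK x0) ge0_ler_powR ?nnegrE ?powR_ge0// ltW.
by rewrite -(powRK s0) ge0_ler_powR ?nnegrE ?powR_ge0 ?invr_ge0 ?(ltW p_gt0).
Qed.

Lemma powR_convex (t x y : R) : 0 <= t <= 1 -> 0 <= x -> 0 <= y ->
  (t * x + (1 - t) * y) `^ p <= t * x `^ p + (1 - t) * y `^ p.
Proof.
case/andP => t0 t1 x0 y0.
have := @convex_powR R p p_ge1 (Itv01 t0 t1) x y.
by rewrite !inE /= !in_itv /= !andbT !convRE /=; apply.
Qed.

Definition rnorm (l : seq int) (x : int -> R) : R := (\sum_(n <- l) x n `^ p) `^ p^-1.

Let sum_ge0 (l : seq int) (x : int -> R) : 0 <= \sum_(n <- l) x n `^ p.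
Proof. by apply: sumr_ge0 => n _; rewrite powR_ge0. Qed.

Lemma rnorm_ge0 l x : 0 <= rnorm l x.
Proof. exact: powR_ge0. Qed.

Lemma rnorm_le l x s : 0 <= s -> (rnorm l x <= s) = (\sum_(n <- l) x n `^ p <= s `^ p).
Proof. exact: powRV_le. Qed.

Lemma rnorm_mono l x y : (forall n, 0 <= x n <= y n) -> rnorm l x <= rnorm l y.
Proof.
move=> h; rewrite rnorm_le ?rnorm_ge0// powRVK//; apply: ler_sum => n _.
have /andP[x0 xy] := h n.
by rewrite ge0_ler_powR ?nnegrE ?(ltW p_gt0)// (le_trans x0).
Qed.

Lemma rnormZ l x c : 0 <= c -> (forall n, 0 <= x n) ->
  rnorm l (fun n => c * x n) = c * rnorm l x.
Proof.
move=> c0 x0; rewrite /rnorm.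
under eq_bigr do rewrite powRM//.
by rewrite -mulr_sumr powRM ?powR_ge0// powRK.
Qed.

Lemma rnorm_eq0 l x : (forall n, 0 <= x n) -> rnorm l x = 0 ->
  forall n, n \in l -> x n = 0.
Proof.
move=> x0 /powR_eq0_eq0 /eqP.
rewrite psumr_eq0 => [/allP h n nl|n _]; last exact: powR_ge0.
by have /eqP/powR_eq0_eq0 := h _ nl.
Qed.

Let powRV_inv (z : R) : 0 < z -> z^-1 `^ p = (z `^ p)^-1.
Proof. by move=> z0; rewrite -powR_inv1 ?ltW// -powRrM mulN1r powRN. Qed.

Let convex_split (X Y u v : R) : 0 < X -> 0 < Y ->
  u + v = (X + Y) * (X / (X + Y) * (X^-1 * u) + (1 - X / (X + Y)) * (Y^-1 * v)).
Proof.
move=> X0 Y0; have ? : X + Y != 0 by rewrite gt_eqF// addr_gt0.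
by field; rewrite !gt_eqF// addr_gt0.
Qed.

(** Convexity of the p-th power: with X and Y the two norms, x + y is X + Y times the convex
    combination of the unit vectors x / X and y / Y with weights X / (X + Y) and Y / (X + Y).
    Vanishing norms, which cannot be normalised, are set apart. *)
Lemma rnormD l x y : (forall n, 0 <= x n) -> (forall n, 0 <= y n) ->
  rnorm l (fun n => x n + y n) <= rnorm l x + rnorm l y.
Proof.
move=> x0 y0.
have [Y0|Y0] := eqVneq (rnorm l y) 0; last have [X0|X0] := eqVneq (rnorm l x) 0.
- rewrite Y0 addr0 /rnorm (eq_big_seq (fun n => x n `^ p))// => n nl.
  by rewrite (rnorm_eq0 y0 Y0 nl) addr0.
- rewrite X0 add0r /rnorm (eq_big_seq (fun n => y n `^ p))// => n nl.
  by rewrite (rnorm_eq0 x0 X0 nl) add0r.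
have {}X0 : 0 < rnorm l x by rewrite lt0r X0 rnorm_ge0.
have {}Y0 : 0 < rnorm l y by rewrite lt0r Y0 rnorm_ge0.
have EX : \sum_(i <- l) x i `^ p = rnorm l x `^ p by rewrite powRVK.
have EY : \sum_(i <- l) y i `^ p = rnorm l y `^ p by rewrite powRVK.
move: (rnorm l x) (rnorm l y) X0 Y0 EX EY => X Y X0 Y0 EX EY.
have XY0 : 0 < X + Y by rewrite addr_gt0.
rewrite (rnorm_le _ _ (ltW XY0)).
pose t := X / (X + Y).
have t01 : 0 <= t <= 1.
  rewrite /t divr_ge0 ?(ltW X0) ?(ltW XY0)//=.
  by rewrite ler_pdivrMr// mul1r lerDl (ltW Y0).
apply: (@le_trans _ _ (\sum_(n <- l) (X + Y) `^ p *
   (t * (X `^ p)^-1 * x n `^ p + (1 - t) * (Y `^ p)^-1 * y n `^ p))).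
  apply: ler_sum => n _.
  have -> : x n + y n = (X + Y) * (t * (X^-1 * x n) + (1 - t) * (Y^-1 * y n)).
    exact: convex_split.
  have xn : 0 <= X^-1 * x n by rewrite mulr_ge0 ?invr_ge0 ?(ltW X0) ?(ltW Y0).
  have yn : 0 <= Y^-1 * y n by rewrite mulr_ge0 ?invr_ge0 ?(ltW X0) ?(ltW Y0).
  have /andP[t0 t_1] := t01.
  rewrite powRM ?(ltW XY0)//; last by rewrite addr_ge0// mulr_ge0// subr_ge0.
  rewrite ler_wpM2l ?powR_ge0// (le_trans (powR_convex t01 xn yn))//.
  rewrite !powRM ?invr_ge0 ?(ltW X0) ?(ltW Y0)// !mulrA.
  by rewrite !powRV_inv.
rewrite -mulr_sumr big_split /= -!mulr_sumr.
rewrite EX EY.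
rewrite !mulfVK ?gt_eqF ?powR_gt0//.
by rewrite addrC subrK mulr1.
Qed.

(** The factor [size l] in place of its p-th root is crude, but enough for limits taken with [l]
    fixed. *)
Lemma rnorm_le_size l x e : 0 <= e -> (forall n, n \in l -> 0 <= x n <= e) ->
  rnorm l x <= (size l)%:R * e.
Proof.
move=> e0 h; rewrite rnorm_le ?mulr_ge0// powRM//.
apply: (@le_trans _ _ (\sum_(n <- l) e `^ p)).
  rewrite big_seq_cond [leRHS]big_seq_cond; apply: ler_sum => n /andP[nl _].
  have /andP[x0 xe] := h _ nl.
  by rewrite ge0_ler_powR ?nnegrE ?(ltW p_gt0).
rewrite big_const_seq count_predT iter_addr addr0 -[leLHS]mulr_natl ler_wpM2r ?powR_ge0//.
by case: (size l) => [|m]; rewrite ?powR_ge0// le1r_powR// ler1n.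
Qed.

End FiniteMinkowski.

(** * Weights with natural exponent *)

Section Weights.
Variable R : realType.

Definition wt (k : nat) (n : int) : R := Num.max 1 (`|n|%:~R ^+ k).

Lemma omega_wt k n : omega (k%:Z%:~R : R) n = wt k n.
Proof. by rewrite /omega /wt powR_mulrn// ler0z. Qed.

Lemma wt_ge1 k n : 1 <= wt k n.
Proof. by rewrite /wt le_max lexx. Qed.

Lemma wt_gt0 k n : 0 < wt k n.
Proof. exact: lt_le_trans ltr01 (wt_ge1 k n). Qed.

Lemma wt_ge0 k n : 0 <= wt k n.
Proof. exact: ltW (wt_gt0 k n). Qed.

Lemma wt0 n : wt 0 n = 1.
Proof. by rewrite /wt expr0 maxxx. Qed.

Let norm_ge1 (n : int) : n != 0 -> 1 <= `|n|%:~R :> R.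
Proof. by move=> n0; rewrite (_ : 1 = 1%:~R)// ler_int; lia. Qed.

Lemma wt_neq0 k n : n != 0 -> wt k n = `|n|%:~R ^+ k.
Proof. by move=> n0; rewrite /wt max_r// exprn_ege1// norm_ge1. Qed.

Lemma wt_at0 k : wt k 0 = 1.
Proof. by rewrite /wt normr0 expr0n; case: k => [|k]; rewrite ?maxxx// max_l. Qed.

Lemma wtS k n : n != 0 -> wt k.+1 n = `|n|%:~R * wt k n.
Proof. by move=> n0; rewrite !wt_neq0// exprS. Qed.

Lemma wt_norm_le k n : `|n|%:~R * wt k n <= wt k.+1 n.
Proof.
have [->|n0] := eqVneq n 0; first by rewrite normr0 mul0r wt_ge0.
by rewrite wtS.
Qed.

Lemma wt_mono j k n : (j <= k)%N -> wt j n <= wt k n.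
Proof.
move=> jk; have [->|n0] := eqVneq n 0; first by rewrite !wt_at0.
by rewrite !wt_neq0// ler_weXn2l// norm_ge1.
Qed.

(** If n is the larger index in absolute value, then |m + n| <= 2 |n|. This inequality is what makes
    the weighted spaces stable under convolution. *)
Lemma wtD_le k m n : wt k (m + n) <= 2 ^+ k * (wt k m + wt k n).
Proof.
wlog mn : m n / `|m| <= `|n|.
  have [mn|/ltW nm] := leP `|m| `|n|; first by apply.
  by rewrite addrC [wt k m + _]addrC; apply.
apply: (@le_trans _ _ (2 ^+ k * wt k n)); last first.
  by rewrite ler_wpM2l ?exprn_ge0// lerDr wt_ge0.
have c1 : 1 <= 2 ^+ k :> R by rewrite exprn_ege1// ler1n.
rewrite [leLHS]/wt ge_max; apply/andP; split.
  by rewrite (le_trans (wt_ge1 k n))// ler_peMl ?wt_ge0.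
apply: (@le_trans _ _ (2 ^+ k * `|n|%:~R ^+ k)).
  rewrite -exprMn lerXn2r ?nnegrE ?mulr_ge0 ?ler0z//.
  by rewrite -(intrM R 2) ler_int; lia.
by rewrite ler_wpM2l ?exprn_ge0// /wt le_max lexx orbT.
Qed.

End Weights.

(** * Convergence of the Riemann series for exponents above 1 *)

Section Riemann.
Variables (R : realType) (q : R).
Hypothesis q_gt1 : 1 < q.

Let r := q - 1.
Let r_gt0 : 0 < r. Proof. by rewrite /r subr_gt0. Qed.

(** The right side telescopes. The estimate amounts to ((n + 1) / n)^r >= 1 + r / (n + 1), which
    follows from exp x >= 1 + x and ln (1 - 1 / (n + 1)) <= - 1 / (n + 1). *)
Let riemann_step (n : nat) : (0 < n)%N ->
  n.+1%:R `^ (- q) <= r^-1 * (n%:R `^ (- r) - n.+1%:R `^ (- r)) :> R.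
Proof.
move=> n0; have nR : 0 < n%:R :> R by rewrite ltr0n.
have n1R : 0 < n.+1%:R :> R by rewrite ltr0n.
rewrite ler_pdivlMl//.
pose E : R := (n.+1%:R / n%:R) `^ r.
have EA : n%:R `^ (- r) = n.+1%:R `^ (- r) * E.
  rewrite /E powRM ?invr_ge0 ?ltW// mulrA -powRD ?addNr ?eqxx ?implybT//; last first.
    by rewrite gt_eqF// implybT.
  by rewrite powRr0 mul1r -powR_inv1 ?ltW// -powRrM mulN1r.
have hE : 1 + r / n.+1%:R <= E.
  rewrite /E /powR gt_eqF ?divr_gt0//.
  apply: le_trans (expR_ge1Dx _); rewrite lerD2l ler_wpM2l ?(ltW r_gt0)//.
  rewrite ln_div ?posrE// -opprB -ln_div ?posrE// lerNr.
  have -> : n%:R / n.+1%:R = 1 + - n.+1%:R^-1 :> R.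
    have h0 : n%:R + 1 != 0 :> R by rewrite natr1 gt_eqF.
    by rewrite -natr1; field.
  apply: le_ln1Dx; rewrite ltrN2 invf_lt1// ltr1n; lia.
rewrite EA -[X in _ - X]mulr1 -mulrBr.
have -> : n.+1%:R `^ (- q) = n.+1%:R `^ (- r) / n.+1%:R :> R.
  rewrite (_ : - q = - r - 1); last by rewrite /r; ring.
  by rewrite powRB ?(gt_eqF n1R) ?implybT// powRr1// ltW.
by rewrite mulrCA ler_wpM2l ?powR_ge0// lerBrDl.
Qed.

(** The 3 accounts for the indices -1, 0 and 1, the factor 2 for the two signs; the subtracted power
    is kept so that the induction closes. *)
Lemma riemann_win N :
  \sum_(n <- win N.+1) (Num.max 1 (`|n|%:~R : R)) `^ (- q) <=
  3 + 2 * r^-1 * (1 - N.+1%:R `^ (- r)).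
Proof.
elim: N => [|N IH].
  rewrite big_winS big_map /= big_cons big_nil addr0.
  rewrite subrr normr0 normrN normr1 !max_l// !powR1. lra.
rewrite big_winS !normrN (_ : `|N.+2%:Z| = N.+2%:Z)//.
rewrite max_r; last by rewrite -[X in X <= _]/(1%:~R) ler_int.
have := @riemann_step N.+1 isT.
set u := _ `^ (- q); set v := N.+1%:R `^ _; set v' := N.+2%:R `^ _ => h.
apply: le_trans (_ : u + (3 + 2 * r^-1 * (1 - v)) + u <= _).
  by rewrite lerD2r lerD2l.
by rewrite (_ : 2 * r^-1 * (1 - v') = 2 * r^-1 * (1 - v) + 2 * (r^-1 * (v - v'))); [lra|ring].
Qed.

Lemma riemann_bounded : exists Z : R, 0 <= Z /\ forall l : seq int, uniq l ->
  \sum_(n <- l) (Num.max 1 (`|n|%:~R : R)) `^ (- q) <= Z.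
Proof.
have r2 : 0 <= 2 * r^-1 by rewrite mulr_ge0 ?invr_ge0 ?(ltW r_gt0).
exists (3 + 2 * r^-1); split; first by rewrite addr_ge0.
move=> l ul; have [N hN] := sub_win l.
apply: le_trans (ler_sum_sub _ ul (hN N.+1 (leqnSn N))) _ => [n|].
  exact: powR_ge0.
apply: le_trans (riemann_win N) _; rewrite lerD2l.
by rewrite ler_piMr// gerBl powR_ge0.
Qed.

End Riemann.

(** * Weighted sequence spaces: norms, tails and completeness *)

Definition delta {R : realType} (n m : int) : R[i] := (m == n)%:R.

Definition trunc {R : realType} (l : seq int) (f : int -> R[i]) (n : int) : R[i] :=
  if n \in l then f n else 0.

(* [nle p k s f] says that the norm of [f] in [l^p(Z, omega_k)] is at most [s];
   in particular it implies that [f] belongs to this space. *)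
Definition nle {R : realType} (p : R) (k : nat) (s : R) (f : int -> R[i]) : Prop :=
  forall l, uniq l -> rnorm p l (fun n => cmod (f n) * wt R k n) <= s.

Lemma eventually_all (P : int -> nat -> Prop) (l : seq int) :
  (forall n, exists N, forall i, (N <= i)%N -> P n i) ->
  exists N, forall i, (N <= i)%N -> forall n, n \in l -> P n i.
Proof.
move=> h; elim: l => [|n l [N hN]]; first by exists 0%N.
have [M hM] := h n; exists (maxn N M) => i; rewrite geq_max => /andP[Ni Mi] m.
by rewrite inE => /predU1P[->|/(hN _ Ni)//]; apply: hM.
Qed.

Lemma geometric_small (R : realType) (x e : R) : 0 <= x -> 0 < e ->
  exists N : nat, x / 2 ^+ N <= e.
Proof.
move=> x0 e0; have := archi_boundP (divr_ge0 x0 (ltW e0)).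
set N := Num.bound _ => /ltW h; exists N.
rewrite ler_pdivrMr ?exprn_gt0// mulrC -ler_pdivrMr//; apply: le_trans h _.
by rewrite -natrX ler_nat ltnW// ltn_expl.
Qed.

Section WeightedNorm.
Variables (R : realType) (p : R).
Hypothesis p_ge1 : 1 <= p.

Let p_gt0 : 0 < p. Proof. exact: lt_le_trans ltr01 p_ge1. Qed.
Let p_neq0 : p != 0. Proof. exact: lt0r_neq0. Qed.

Implicit Types (f g : int -> R[i]) (k : nat) (s t : R).

Let term_ge0 k f n : 0 <= cmod (f n) * wt R k n.
Proof. by rewrite mulr_ge0 ?cmod_ge0 ?wt_ge0. Qed.

Lemma nle_ge0 k s f : nle p k s f -> 0 <= s.
Proof. by move=> /(_ [::] isT); apply: le_trans; apply: powR_ge0. Qed.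

Lemma nle_sumP k s f : 0 <= s -> nle p k s f <->
  forall l, uniq l -> \sum_(n <- l) (cmod (f n) * wt R k n) `^ p <= s `^ p.
Proof. by move=> s0; split=> h l /h; rewrite rnorm_le. Qed.

Lemma nle_weaken k s t f : s <= t -> nle p k s f -> nle p k t f.
Proof. by move=> st h l /h/le_trans; apply. Qed.

Lemma nle_dom j k c s f g : 0 <= c ->
  (forall n, cmod (f n) * wt R j n <= c * (cmod (g n) * wt R k n)) ->
  nle p k s g -> nle p j (c * s) f.
Proof.
move=> c0 h hg l ul.
apply: (@le_trans _ _ (rnorm p l (fun n => c * (cmod (g n) * wt R k n)))).
  by apply: rnorm_mono => // n; rewrite term_ge0 h.
by rewrite rnormZ// ler_wpM2l// hg.
Qed.

Lemma nle_le j k s f g :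
  (forall n, cmod (f n) * wt R j n <= cmod (g n) * wt R k n) ->
  nle p k s g -> nle p j s f.
Proof. by move=> h /(nle_dom ler01); rewrite mul1r; apply=> n; rewrite mul1r. Qed.

Lemma nle_mono j k s f : (j <= k)%N -> nle p k s f -> nle p j s f.
Proof. by move=> jk; apply: nle_le => n; rewrite ler_wpM2l ?cmod_ge0 ?wt_mono. Qed.

Lemma nle_add k s t f g : nle p k s f -> nle p k t g ->
  nle p k (s + t) (fun n => f n + g n).
Proof.
move=> hf hg l ul; apply: le_trans (lerD (hf _ ul) (hg _ ul)).
apply: le_trans (rnormD p_ge1 _ (term_ge0 k f) (term_ge0 k g)).
apply: rnorm_mono => // n.
by rewrite (term_ge0 _ (fun n => f n + g n)) -mulrDl ler_wpM2r ?wt_ge0 ?cmodD.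
Qed.

Lemma nle_scale k s (c : R[i]) f : nle p k s f -> nle p k (cmod c * s) (fun n => c * f n).
Proof. by apply: nle_dom; rewrite ?cmod_ge0// => n; rewrite cmodM mulrA. Qed.

Lemma nle_lin k s t (c : R[i]) f g : nle p k s f -> nle p k t g ->
  nle p k (cmod c * s + t) (fun n => c * f n + g n).
Proof. by move=> hf hg; apply: (@nle_add _ _ _ (fun n => c * f n)) => //; apply: nle_scale. Qed.

Lemma nle_opp k s f : nle p k s f -> nle p k s (fun n => - f n).
Proof. by apply: nle_le => n; rewrite cmodN. Qed.

Lemma nle_sub k s t f g : nle p k s f -> nle p k t g ->
  nle p k (s + t) (fun n => f n - g n).
Proof. by move=> hf /nle_opp; apply: nle_add. Qed.

Lemma nle_coord k s f n : nle p k s f -> cmod (f n) * wt R k n <= s.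
Proof.
by move=> /(_ [:: n] isT); rewrite /rnorm big_cons big_nil addr0 powRK ?term_ge0.
Qed.

Lemma nle_cmod k s f n : nle p k s f -> cmod (f n) <= s.
Proof.
by move=> /nle_coord h; apply: le_trans (h n); rewrite ler_peMr ?cmod_ge0 ?wt_ge1.
Qed.

Lemma nle0_eq0 k f : nle p k 0 f -> f = (fun=> 0).
Proof.
move=> h; apply/funext => n; apply/cmod_eq0/eqP.
by rewrite eq_le cmod_ge0 (nle_cmod _ h).
Qed.

Lemma nle_zero k : nle p k 0 (fun=> 0).
Proof.
apply/nle_sumP => // l _; rewrite big1 ?powR_ge0// => n _.
by rewrite cmod0 mul0r powR0.
Qed.

Lemma nle_delta k n : nle p k (wt R k n) (delta n).
Proof.
apply/nle_sumP => [|l ul]; first exact: wt_ge0.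
have E m : m != n -> (cmod (delta n m : R[i]) * wt R k m) `^ p = 0.
  by move=> mn; rewrite /delta (negPf mn) cmod0 mul0r powR0.
have [nl|nl] := boolP (n \in l).
  rewrite (bigD1_seq n)//= big1 ?addr0; last by move=> m; exact: E.
  by rewrite /delta eqxx cmod1 mul1r.
rewrite big_seq_cond big1 ?powR_ge0// => m /andP[ml _]; apply: E.
by apply: contraNneq nl => <-.
Qed.

Lemma trunc_cons n l f : n \notin l ->
  trunc (n :: l) f = (fun m => f n * delta n m + trunc l f m).
Proof.
move=> nl; apply/funext => m; rewrite /trunc /delta inE.
have [->|_] /= := eqVneq m n; first by rewrite (negPf nl) mulr1 addr0.
by rewrite mulr0 add0r.
Qed.

Lemma nle_trunc_ex k l f : uniq l -> exists s, nle p k s (trunc l f).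
Proof.
elim: l => [_|n l IH /= /andP[nl /IH[s hs]]]; first by exists 0; apply: nle_zero.
by rewrite trunc_cons//; eexists; apply: nle_lin hs; apply: nle_delta.
Qed.

Lemma nle_trunc k s l f : nle p k s f -> nle p k s (trunc l f).
Proof.
apply: nle_le => n; rewrite /trunc; case: ifP => // _.
by rewrite cmod0 mul0r term_ge0.
Qed.

(** Every inequality in [nle] involves finitely many coefficients, so balls are closed under mere
    coefficientwise convergence. Most limits below are taken in this way. *)
Lemma nle_lim k s (u : nat -> int -> R[i]) f :
  (exists N, forall i, (N <= i)%N -> nle p k s (u i)) ->
  (forall n, ccvg (fun i => u i n) (f n)) -> nle p k s f.
Proof.
move=> [N0 hs] hu l ul; apply/ler_addgt0Pr => e e0.
(* This offsets the factor [size l] of [rnorm_le_size]; the successor covers the empty list. *)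
pose d := e / (size l).+1%:R.
have d0 : 0 < d by rewrite divr_gt0.
have [N hN] : exists N, forall i, (N <= i)%N -> forall n, n \in l ->
    cmod (u i n - f n) * wt R k n <= d.
  apply: (@eventually_all (fun n i => cmod (u i n - f n) * wt R k n <= d)) => n.
  have [N hN] := hu n _ (divr_gt0 d0 (wt_gt0 R k n)).
  by exists N => i /hN; rewrite ler_pdivlMr ?wt_gt0.
pose i := maxn N0 N.
have h1 := hs i (leq_maxl _ _); have h2 := hN i (leq_maxr _ _).
apply: (@le_trans _ _ (rnorm p l (fun n => cmod (u i n) * wt R k n) +
                       rnorm p l (fun n => cmod (u i n - f n) * wt R k n))).
  apply: le_trans (rnormD p_ge1 _ (term_ge0 k _) (term_ge0 k (fun n => u i n - f n))).
  apply: rnorm_mono => // n; rewrite term_ge0 -mulrDl ler_wpM2r ?wt_ge0//.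
  by rewrite [X in cmod X](_ : f n = u i n - (u i n - f n)) ?cmodB//; ring.
rewrite lerD ?h1//.
apply: le_trans (rnorm_le_size p_ge1 (ltW d0) _) _.
  by move=> n nl; rewrite (term_ge0 _ (fun n => u i n - f n)) h2.
rewrite /d mulrCA ler_piMr ?(ltW e0)// ler_pdivrMr ?ltr0Sn// mul1r ler_nat//.
Qed.

(** The supremum of this set is the p-th power of the norm. *)
Let sums k f := [set x | exists2 l : seq int, uniq l &
  x = \sum_(n <- l) (cmod (f n) * wt R k n) `^ p]%classic.

Let sums_sup k s f : nle p k s f -> has_sup (sums k f).
Proof.
move=> h; have s0 := nle_ge0 h; split; first by exists 0, [::]; rewrite ?big_nil.
by exists (s `^ p) => _ [l ul ->]; apply: ((nle_sumP k f s0).1 h).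
Qed.

(** The least bound is the norm proper. It is needed to absorb a term that is itself a fraction of
    the norm being estimated. *)
Lemma nle_min k s f : nle p k s f ->
  exists m, nle p k m f /\ forall t, nle p k t f -> m <= t.
Proof.
move=> h; have hS := sums_sup h.
have S0 : 0 <= sup (sums k f).
  by apply: sup_upper_bound => //; exists [::]; rewrite ?big_nil.
exists (sup (sums k f) `^ p^-1); split=> [|t ht].
  apply/nle_sumP => [|l ul]; first exact: powR_ge0.
  by rewrite powRVK//; apply: sup_upper_bound => //; exists l.
have t0 := nle_ge0 ht.
rewrite powRV_le//; apply: ge_sup; first by case: hS.
by move=> _ [l ul ->]; apply: ((nle_sumP k f t0).1 ht).
Qed.

(** A finite set whose sum is within e^p of the supremum leaves less than e^p to any finite set
    outside a window that contains it. *)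
Lemma nle_tail k s f : nle p k s f -> forall e, 0 < e ->
  exists N, forall M, (N <= M)%N -> nle p k e (fun n => f n - trunc (win M) f n).
Proof.
move=> h e e0; have hS := sums_sup h.
have ep0 : 0 < e `^ p by rewrite powR_gt0.
have [_ [l ul ->] hl] := sup_adherent ep0 hS.
have [N hN] := sub_win l; exists N => M NM.
apply/nle_sumP => [|l' ul']; first exact: ltW.
pose x n := (cmod (f n) * wt R k n) `^ p.
have -> : \sum_(n <- l') (cmod (f n - trunc (win M) f n) * wt R k n) `^ p =
          \sum_(n <- [seq m <- l' | m \notin win M]) x n.
  rewrite big_filter [RHS]big_mkcond; apply: eq_bigr => n _; rewrite /trunc /x.
  case: ifP => _ /=; last by rewrite subr0.
  by rewrite subrr cmod0 mul0r powR0.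
have h1 : \sum_(n <- l) x n <= \sum_(n <- win M) x n.
  by apply: ler_sum_sub (hN _ NM) => // n; rewrite powR_ge0.
have : \sum_(n <- win M ++ [seq m <- l' | m \notin win M]) x n <= sup (sums k f).
  apply: sup_upper_bound => //.
  exists (win M ++ [seq m <- l' | m \notin win M]) => //.
  rewrite cat_uniq win_uniq filter_uniq// andbT /=.
  by apply/hasPn => n; rewrite mem_filter => /andP[].
move: hl; rewrite big_cat /= -/x => hl h2.
have := le_trans (lerD h1 (lexx _)) h2.
set A := \sum_(n <- l) _ in hl *; set B := \sum_(n <- _) _; lra.
Qed.

Lemma nle_complete k (u : nat -> int -> R[i]) :
  (forall e, 0 < e -> exists N, forall i j, (N <= i)%N -> (N <= j)%N ->
     nle p k e (fun n => u i n - u j n)) ->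
  exists f, forall e, 0 < e -> exists N, forall i, (N <= i)%N ->
     nle p k e (fun n => f n - u i n).
Proof.
move=> h.
have /choice[f hf] n : exists l, ccvg (fun i => u i n) l.
  apply: ccvg_cauchy => e /h[N hN]; exists N => i j Ni Nj.
  exact: nle_cmod (hN _ _ Ni Nj).
exists f => e /h[N hN]; exists N => i Ni.
apply: (@nle_lim _ _ (fun j n => u j n - u i n)) => [|n].
  by exists N => j Nj; apply: hN.
move=> d /(hf n)[M hM]; exists M => j /hM.
by rewrite (_ : u j n - u i n - (f n - u i n) = u j n - f n)//; ring.
Qed.

Lemma nle_geometric k c (u : nat -> int -> R[i]) :
  (forall i, nle p k (c / 2 ^+ i) (fun n => u i.+1 n - u i n)) ->
  exists f, forall i, nle p k (2 * c / 2 ^+ i) (fun n => f n - u i n).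
Proof.
move=> h; have c0 : 0 <= c by move: (nle_ge0 (h 0%N)); rewrite expr0 divr1.
have P2 i : 0 < 2 ^+ i :> R by rewrite exprn_gt0.
(* The bound is the exact sum of the geometric steps between [i] and i + m, hence the factor 2 in
   the conclusion. *)
have hij i m : nle p k (2 * c / 2 ^+ i - 2 * c / 2 ^+ (i + m)) (fun n => u (i + m)%N n - u i n).
  elim: m => [|m IH].
    rewrite addn0 subrr (_ : (fun n => _) = (fun=> 0)); first exact: nle_zero.
    by apply/funext => n; rewrite subrr.
  have := nle_add (h (i + m)%N) IH; rewrite addnS.
  rewrite (_ : (fun n => _) = (fun n => u (i + m).+1 n - u i n)); last first.
    by apply/funext => n; ring.
  apply: nle_weaken; rewrite exprS; have := P2 (i + m)%N; have := P2 i.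
  move: (2 ^+ (i + m)) (2 ^+ i) => x y y0 x0; rewrite le_eqVlt; apply/orP; left.
  by apply/eqP; field; rewrite !gt_eqF.
have hle i j : (i <= j)%N -> nle p k (2 * c / 2 ^+ i) (fun n => u j n - u i n).
  move=> ij; rewrite -(subnKC ij); apply: nle_weaken (hij i (j - i)%N).
  by rewrite gerBl divr_ge0 ?mulr_ge0// ltW.
have [e e0|f hf] := @nle_complete k u.
  have [N hN] : exists N : nat, 2 * c / 2 ^+ N <= e / 2.
    apply: geometric_small; first by rewrite mulr_ge0.
    by rewrite divr_gt0.
  exists N => i j Ni Nj.
  have := nle_sub (hle _ _ Ni) (hle _ _ Nj).
  rewrite (_ : (fun n => _) = (fun n => u i n - u j n)); last first.
    by apply/funext => n; ring.
  by apply: nle_weaken; rewrite (splitr e) lerD.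
exists f => i; apply: (@nle_lim _ _ (fun j n => u j n - u i n)) => [|n].
  by exists i => j; exact: hle.
move=> d /hf[M hM]; exists M => j Mj; move: (nle_cmod n (hM _ Mj)).
by rewrite (_ : u j n - u i n - (f n - u i n) = u j n - f n) 1?cmodBC//; ring.
Qed.

End WeightedNorm.

(** * Unconditional summation over the integers *)

Section UnorderedSums.
Variable R : realType.
Implicit Types (u v : int -> R[i]) (l L : R[i]) (B : R).

(** Convergence along the finite sets of indices. Unlike the symmetric partial sums behind [zsum],
    it is stable under reindexing, and [has_zsumE] recovers [zsum] from it. *)
Definition has_zsum u L := forall e : R, 0 < e -> exists s0 : seq int,
  forall s, uniq s -> {subset s0 <= s} -> cmod (\sum_(n <- s) u n - L) <= e.

(** Throughout, [nle 1 0] plays the role of the l^1 norm. *)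
Lemma l1P B u : nle 1 0 B u <->
  0 <= B /\ forall s, uniq s -> \sum_(n <- s) cmod (u n) <= B.
Proof.
have E s : \sum_(n <- s) (cmod (u n) * wt R 0 n) `^ 1 = \sum_(n <- s) cmod (u n).
  by apply: eq_bigr => n _; rewrite wt0 mulr1 powRr1 ?cmod_ge0.
split=> [h|[B0 h]].
  have B0 := nle_ge0 h; split=> // s us.
  by have := (nle_sumP (lexx 1) 0 u B0).1 h s us; rewrite E powRr1.
by apply/(nle_sumP (lexx 1) 0 u B0) => s us; rewrite E powRr1// h.
Qed.

Lemma has_zsum_ccvg u L : has_zsum u L -> ccvg (fun N => \sum_(n <- win N) u n) L.
Proof.
move=> h e /h[s0 hs]; have [N hN] := sub_win s0.
by exists N => n /hN; apply: hs; exact: win_uniq.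
Qed.

Lemma has_zsum_unique u L L' : has_zsum u L -> has_zsum u L' -> L = L'.
Proof. by move=> /has_zsum_ccvg h /has_zsum_ccvg; apply: ccvg_unique. Qed.

Lemma has_zsumE u L : has_zsum u L -> zsum u = L.
Proof.
move=> /has_zsum_ccvg; rewrite -(funext (zpsum_win u)) => h.
rewrite /zsum (cvg_lim _ (rcvg_cvg (ccvg_Re h)))//.
by rewrite (cvg_lim _ (rcvg_cvg (ccvg_Im h)))//; case: (L).
Qed.

Lemma has_zsum_lin (c : R[i]) u v L L' : has_zsum u L -> has_zsum v L' ->
  has_zsum (fun n => c * u n + v n) (c * L + L').
Proof.
move=> h h' e e0.
have c0 : 0 < cmod c + 1 by rewrite ltr_pwDr ?cmod_ge0.
have e2 : 0 < e / 2 by rewrite divr_gt0.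
have [s1 h1] := h _ (divr_gt0 e2 c0); have [s2 h2] := h' _ e2.
exists (s1 ++ s2) => s us ss.
have {}h1 : cmod (\sum_(n <- s) u n - L) <= e / 2 / (cmod c + 1).
  by apply: h1 => // n ns; apply: ss; rewrite mem_cat ns.
have {}h2 : cmod (\sum_(n <- s) v n - L') <= e / 2.
  by apply: h2 => // n ns; apply: ss; rewrite mem_cat ns orbT.
rewrite big_split /= -mulr_sumr.
move: (\sum_(n <- s) u n) (\sum_(n <- s) v n) h1 h2 => a b h1 h2.
have -> : c * a + b - (c * L + L') = c * (a - L) + (b - L') by ring.
rewrite (le_trans (cmodD _ _))// (splitr e) lerD// cmodM.
apply: le_trans (_ : (cmod c + 1) * (e / 2 / (cmod c + 1)) <= _); last first.
  by rewrite mulrC divfK// gt_eqF.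
by rewrite ler_pM ?cmod_ge0// lerDl.
Qed.

Lemma has_zsum_nneg (v : int -> R) B : (forall n, 0 <= v n) ->
  (forall s, uniq s -> \sum_(n <- s) v n <= B) ->
  exists L, has_zsum (fun n => (v n)%:C%C) L.
Proof.
move=> v0 hB; pose E := [set x | exists2 s : seq int, uniq s & x = \sum_(n <- s) v n]%classic.
have hE : has_sup E.
  by split; [exists 0, [::]; rewrite ?big_nil|exists B => _ [s us ->]; apply: hB].
exists (sup E)%:C%C => e e0; have [_ [s0 us0 ->] hs0] := sup_adherent e0 hE.
exists s0 => s us ss.
have h1 : \sum_(n <- s) v n <= sup E by apply: sup_upper_bound => //; exists s.
have h2 : \sum_(n <- s0) v n <= \sum_(n <- s) v n by apply: ler_sum_sub.
rewrite -rmorph_sum -rmorphB cmod_real distrC ger0_norm ?subr_ge0//.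
rewrite lerBlDl; move: (\sum_(n <- s) _) (\sum_(n <- s0) _) h1 h2 hs0 => *; lra.
Qed.

Lemma has_zsum_ge (v : int -> R) L s : (forall n, 0 <= v n) ->
  has_zsum (fun n => (v n)%:C%C) L -> uniq s -> \sum_(n <- s) v n <= cmod L.
Proof.
move=> v0 h us; apply/ler_addgt0Pr => e /h[s0 hs].
have := hs (undup (s ++ s0)) (undup_uniq _).
set s' := undup _ => /(_ _)/wrap[n ns|].
  by rewrite mem_undup mem_cat ns orbT.
rewrite -rmorph_sum; set x := \sum_(n <- s') v n => h1.
apply: (@le_trans _ _ x).
  by apply: ler_sum_sub => // n ns; rewrite mem_undup mem_cat ns.
have x0 : 0 <= x by apply: sumr_ge0.
rewrite -(ger0_norm x0) -cmod_real.
have -> : x%:C%C = L + (x%:C%C - L) by ring.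
by rewrite (le_trans (cmodD _ _))// lerD2l.
Qed.

Lemma l1_has_zsum B u : nle 1 0 B u -> has_zsum u (zsum u).
Proof.
move=> /l1P[B0 h].
have part (w : int -> R) : (forall n, `|w n| <= cmod (u n)) ->
    exists L, has_zsum (fun n => (w n)%:C%C) L.
  move=> hw.
  (* A real family is the difference of the nonnegative families |w| + w and |w|. *)
  have [||L1 h1] := @has_zsum_nneg (fun n => `|w n| + w n) (2 * B).
  - by move=> n; have := lerNnormlW (lexx `|w n|); lra.
  - move=> s us; apply: (@le_trans _ _ (2 * \sum_(n <- s) cmod (u n))).
      rewrite mulr_sumr; apply: ler_sum => n _.
      by have := hw n; have := ler_norm (w n); lra.
    by rewrite ler_wpM2l// h.
  have [||L2 h2] := @has_zsum_nneg (fun n => `|w n|) B.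
  - by [].
  - by move=> s us; apply: le_trans (h s us); apply: ler_sum => n _.
  exists (-1 * L2 + L1); have := has_zsum_lin (-1) h2 h1.
  congr has_zsum; apply/funext => n.
  by rewrite rmorphD /= mulN1r addrA addNr add0r.
have [a ha] := part (fun n => complex.Re (u n)) (fun n => cmod_Re (u n)).
have [b hb] := part (fun n => complex.Im (u n)) (fun n => cmod_Im (u n)).
have hu := has_zsum_lin ('i%C) hb ha.
suff hh : has_zsum u ('i%C * b + a) by rewrite (has_zsumE hh).
move: hu; congr has_zsum; apply/funext => n; by rewrite addrC -complexE.
Qed.

Lemma cmod_zsum B u : nle 1 0 B u -> cmod (zsum u) <= B.
Proof.
move=> h; have := l1_has_zsum h; move/l1P: h => [B0 h].
move=> hs; apply/ler_addgt0Pr => e e0.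
have [N /(_ _ (leqnn N))] := has_zsum_ccvg hs e0.
set x := \sum_(n <- _) _ => hx.
have -> : zsum u = x - (x - zsum u) by ring.
apply: le_trans (cmodB _ _) _; rewrite lerD// (le_trans (cmod_sum_le _ _))//.
by rewrite h// win_uniq.
Qed.

(** The hypotheses say that [h] is injective and that [u] vanishes off its image. Surjectivity is
    not asked for, so that the sum over even indices is covered. *)
Lemma has_zsum_reindex (h g : int -> int) u L : cancel h g ->
  (forall n, h (g n) != n -> u n = 0) ->
  has_zsum u L -> has_zsum (fun n => u (h n)) L.
Proof.
move=> hg gh hu e /hu[s0 hs]; exists (map g s0) => s us ss.
(* The image of [s] is completed by the rest of [s0], where [u] vanishes: an index of [s0] in the
   image of [h] comes from [map g s0], hence from [s]. *)
have := hs (map h s ++ [seq n <- undup s0 | n \notin map h s]).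
rewrite big_cat big_map /= [X in _ + X - _]big1_seq ?addr0; last first.
  move=> n; rewrite mem_filter mem_undup => /andP[_ /andP[nm ns0]]; apply: gh.
  by apply: contraNneq nm => <-; apply: map_f; apply: ss; apply: map_f.
apply=> [|n ns0].
  rewrite cat_uniq map_inj_uniq ?us ?filter_uniq ?undup_uniq//; last exact: can_inj hg.
  by rewrite andbT /=; apply/hasPn => n; rewrite mem_filter => /andP[].
by rewrite mem_cat mem_filter mem_undup ns0 andbT orbN.
Qed.

Lemma has_zsum_zero u : (forall n, u n = 0) -> has_zsum u 0.
Proof.
by move=> u0 e e0; exists [::] => s _ _; rewrite big1 ?subrr ?cmod0 ?ltW.
Qed.

Lemma has_zsum_delta k u : has_zsum (fun n => delta k n * u n) (u k).
Proof.
move=> e e0; exists [:: k] => s us /(_ k (mem_head _ _)) ks.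
rewrite (bigD1_seq k)//= big1 => [|n nk]; last by rewrite /delta (negPf nk) mul0r.
by rewrite /delta eqxx mul1r addr0 subrr cmod0 ltW.
Qed.

End UnorderedSums.

(** * Convolution and its norm estimates *)

Section Convolution.
Variable R : realType.
Implicit Types (f g : int -> R[i]) (s t : R).

Lemma conv_summable f g s t n : nle 1 0 s f -> (forall n, cmod (g n) <= t) ->
  nle 1 0 (s * t) (fun k => f k * g (n - k)).
Proof.
move=> hf hg; rewrite mulrC.
have t0 : 0 <= t by apply: le_trans (hg 0); exact: cmod_ge0.
apply: (nle_dom (lexx 1) t0 _ hf) => k.
by rewrite mulrA ler_wpM2r ?wt_ge0// cmodM mulrC ler_wpM2r ?cmod_ge0.
Qed.

Lemma conv_has f g s t n : nle 1 0 s f -> (forall n, cmod (g n) <= t) ->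
  has_zsum (fun k => f k * g (n - k)) (conv f g n).
Proof. by move=> hf hg; exact: l1_has_zsum (conv_summable n hf hg). Qed.

Lemma conv_hasC f g s t n : nle 1 0 s f -> (forall n, cmod (g n) <= t) ->
  has_zsum (fun k => g k * f (n - k)) (conv f g n).
Proof.
move=> hf hg; have K : involutive (fun k : int => n - k) by move=> k; ring.
have := has_zsum_reindex K (fun k => _) (conv_has n hf hg) => /(_ _)/wrap[k|].
  by rewrite K eqxx.
by congr has_zsum; apply/funext => k; rewrite subKr mulrC.
Qed.

Lemma conv_comm f g s t : nle 1 0 s f -> (forall n, cmod (g n) <= t) ->
  conv g f = conv f g.
Proof. by move=> hf hg; apply/funext => n; exact: has_zsumE (conv_hasC n hf hg). Qed.

Lemma conv_linl (c : R[i]) f f' g s s' t : nle 1 0 s f -> nle 1 0 s' f' ->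
  (forall n, cmod (g n) <= t) ->
  conv (fun n => c * f n + f' n) g = (fun n => c * conv f g n + conv f' g n).
Proof.
move=> hf hf' hg; apply/funext => n; apply: has_zsumE.
have := has_zsum_lin c (conv_has n hf hg) (conv_has n hf' hg).
by congr has_zsum; apply/funext => k; ring.
Qed.

Lemma conv_linr (c : R[i]) f g g' s t t' : nle 1 0 s f ->
  (forall n, cmod (g n) <= t) -> (forall n, cmod (g' n) <= t') ->
  conv f (fun n => c * g n + g' n) = (fun n => c * conv f g n + conv f g' n).
Proof.
move=> hf hg hg'; apply/funext => n; apply: has_zsumE.
have := has_zsum_lin c (conv_has n hf hg) (conv_has n hf hg').
by congr has_zsum; apply/funext => k; ring.
Qed.

Lemma conv_delta k g n : conv (delta k) g n = g (n - k).
Proof. exact: has_zsumE (has_zsum_delta k (fun j => g (n - j))). Qed.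

Variable p : R.
Hypothesis p_ge1 : 1 <= p.

Lemma nle_shift s f k : nle p 0 s f -> nle p 0 s (fun n => f (n - k)).
Proof.
move=> h l ul; have := h [seq n - k | n <- l].
rewrite map_inj_uniq; last by move=> i j /addIr.
move=> /(_ ul); apply: le_trans; rewrite /rnorm big_map.
by rewrite (eq_bigr (fun n => (cmod (f (n - k)) * wt R 0 (n - k)) `^ p))// => n _; rewrite !wt0.
Qed.

(** The convolution is a limit of combinations of translates of [g] with coefficients f_k, and
    translations are isometric at weight 0. *)
Lemma young f g s t : nle 1 0 s f -> nle p 0 t g -> nle p 0 (s * t) (conv f g).
Proof.
move=> hf hg; have t0 := nle_ge0 hg.
have hgt n : cmod (g n) <= t by exact: nle_cmod hg.
have hsum l : nle p 0 ((\sum_(k <- l) cmod (f k)) * t)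
                (fun n => \sum_(k <- l) f k * g (n - k)).
  elim: l => [|k l IH].
    rewrite big_nil mul0r (_ : (fun n => _) = (fun=> 0)); first exact: nle_zero.
    by apply/funext => n; rewrite big_nil.
  rewrite (_ : (fun n => _) =
    (fun n => f k * g (n - k) + \sum_(j <- l) f j * g (n - j))); last first.
    by apply/funext => n; rewrite big_cons.
  rewrite big_cons mulrDl.
  exact: (nle_lin p_ge1 (f k) (nle_shift k hg) IH).
apply: (nle_lim p_ge1 (u := fun N n => \sum_(k <- win N) f k * g (n - k))).
  exists 0%N => N _; apply: nle_weaken (hsum (win N)); rewrite ler_wpM2r//.
  by move/l1P: hf => [_]; apply; exact: win_uniq.
by move=> n; exact: has_zsum_ccvg (conv_has n hf hgt).
Qed.

(** By [wtD_le] the weight falls on one factor at a time; Young's inequality applies to each of the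
    two terms, with the weighted factor in l^p and the other in l^1. *)
Lemma nle_conv k f g s s' t t' : nle p k s f -> nle p k t g ->
  nle 1 0 s' f -> nle 1 0 t' g ->
  nle p k (2 ^+ k * (s * t' + s' * t)) (conv f g).
Proof.
move=> hf hg hf' hg'.
(* The moduli, with and without weight, are viewed as complex sequences so that [young] applies to
   them. *)
pose F n : R[i] := (cmod (f n) * wt R k n)%:C%C.
pose G n : R[i] := (cmod (g n) * wt R k n)%:C%C.
pose fa n : R[i] := (cmod (f n))%:C%C.
pose ga n : R[i] := (cmod (g n))%:C%C.
have cr x : 0 <= x -> cmod (x%:C%C : R[i]) = x.
  by move=> x0; rewrite cmod_real ger0_norm.
have hF : nle p 0 s F.
  by apply: nle_le hf => // n; rewrite wt0 mulr1 cr// mulr_ge0 ?cmod_ge0 ?wt_ge0.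
have hG : nle p 0 t G.
  by apply: nle_le hg => // n; rewrite wt0 mulr1 cr// mulr_ge0 ?cmod_ge0 ?wt_ge0.
have hfa : nle 1 0 s' fa by apply: nle_le hf' => // n; rewrite cr ?cmod_ge0.
have hga : nle 1 0 t' ga by apply: nle_le hg' => // n; rewrite cr ?cmod_ge0.
have bF n : cmod (F n) <= s by exact: nle_cmod hF.
have bG n : cmod (G n) <= t by exact: nle_cmod hG.
have bg n : cmod (g n) <= t by exact: nle_cmod hg.
have hV := nle_add p_ge1 (young hga hF) (young hfa hG).
rewrite [t' * s]mulrC in hV.
apply: (nle_dom p_ge1 (exprn_ge0 k (ler0n R 2)) _ hV) => n.
rewrite wt0 mulr1 -ler_pdivlMr ?wt_gt0//.
set V := conv ga F n + conv fa G n.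
have hs : has_zsum (fun j => (cmod (f j) * wt R k j * cmod (g (n - j)) +
     cmod (f j) * (cmod (g (n - j)) * wt R k (n - j)))%:C%C) V.
  have := has_zsum_lin 1 (conv_hasC n hga bF) (conv_has n hfa bG); rewrite mul1r.
  by congr has_zsum; apply/funext => j; rewrite mul1r rmorphD /= !rmorphM /= /F /G /fa /ga !rmorphM.
apply: (@cmod_zsum _ _ (fun j => f j * g (n - j))); apply/l1P; split.
  by rewrite !mulr_ge0 ?exprn_ge0 ?cmod_ge0 ?invr_ge0 ?wt_ge0.
move=> l ul; rewrite ler_pdivlMr ?wt_gt0//.
have := has_zsum_ge _ hs ul => /(_ _)/wrap[j|].
  by rewrite addr_ge0// !mulr_ge0 ?cmod_ge0 ?wt_ge0.
move=> hl; apply: le_trans (ler_wpM2l (exprn_ge0 k (ler0n R 2)) hl).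
rewrite mulr_suml mulr_sumr; apply: ler_sum => j _.
rewrite cmodM.
have := wtD_le R k j (n - j); rewrite subrKC => hw.
apply: le_trans (ler_wpM2l (mulr_ge0 (cmod_ge0 (f j)) (cmod_ge0 (g (n - j)))) hw) _.
by rewrite le_eqVlt; apply/orP; left; apply/eqP; ring.
Qed.

End Convolution.

(** * Comparison with the extended sums of the statement, and inclusion in l^1 *)

Section Membership.
Variables (R : realType) (p : R).
Hypothesis p_ge1 : 1 <= p.

Let p_gt0 : 0 < p. Proof. exact: lt_le_trans ltr01 p_ge1. Qed.

Implicit Types (f : int -> R[i]) (F : int -> R).

Lemma esum_le_fin F (B : R) : (forall l, uniq l -> \sum_(n <- l) F n <= B) ->
  (\esum_(n in [set: int]) (F n)%:E <= B%:E)%E.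
Proof.
move=> h; apply: ge_ereal_sup => _ [A [finA _] <-].
by rewrite fsbig_finite//= sumEFin lee_fin h// finmap.fset_uniq.
Qed.

Lemma fin_le_esum F l : uniq l ->
  ((\sum_(n <- l) F n)%:E <= \esum_(n in [set: int]) (F n)%:E)%E.
Proof.
move=> ul; apply: esum_ge; exists [set` l]%classic; first by split=> //; exact: finite_seq.
by rewrite -fsbig_seq// sumEFin.
Qed.

Lemma in_lpwP k f : in_lpw p (k%:Z%:~R) f <-> exists s, nle p k s f.
Proof.
rewrite /in_lpw /lpw_sum.
under eq_esum do rewrite omega_wt.
set E := \esum_(_ in _) _; split=> [Efin|[s hs]].
  have E0 : (0 <= E)%E by apply: esum_ge0 => n _; rewrite lee_fin powR_ge0.
  have Er : E = (fine E)%:E by rewrite fineK// ge0_fin_numE.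
  have r0 : 0 <= fine E by rewrite fine_ge0.
  exists (fine E `^ p^-1); apply/nle_sumP => // [|l ul]; first exact: powR_ge0.
  rewrite powRVK// -lee_fin -Er; exact: fin_le_esum.
have s0 := nle_ge0 hs.
apply: (@le_lt_trans _ _ (s `^ p)%:E); last exact: ltry.
by apply: esum_le_fin => l ul; apply: ((nle_sumP p_ge1 k f s0).1 hs).
Qed.

Let lp_sumE f : lp_sum p f = \esum_(n in [set: int]) ((cmod (f n) * wt R 0 n) `^ p)%:E.
Proof. by apply: eq_esum => n _; rewrite wt0 mulr1. Qed.

Lemma in_lpP f : in_lp p f <-> exists s, nle p 0 s f.
Proof.
rewrite -in_lpwP /in_lp /in_lpw lp_sumE /lpw_sum.
by under [in X in _ <-> X]eq_esum do rewrite omega_wt.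
Qed.

Lemma nle_lp_norm f : in_lp p f -> nle p 0 (lp_norm p f) f.
Proof.
rewrite /in_lp /lp_norm lp_sumE; set E := \esum_(_ in _) _ => Efin.
have E0 : (0 <= E)%E by apply: esum_ge0 => n _; rewrite lee_fin powR_ge0.
have Er : E = (fine E)%:E by rewrite fineK// ge0_fin_numE.
have r0 : 0 <= fine E by rewrite fine_ge0.
apply/nle_sumP => // [|l ul]; first exact: powR_ge0.
by rewrite powRVK// -lee_fin -Er; exact: fin_le_esum.
Qed.

Lemma lp_norm_le f s : nle p 0 s f -> lp_norm p f <= s.
Proof.
move=> hs; have s0 := nle_ge0 hs.
rewrite /lp_norm powRV_le//; last first.
  by rewrite fine_ge0// lp_sumE esum_ge0// => n _; rewrite lee_fin powR_ge0.
rewrite lp_sumE; set E := \esum_(_ in _) _.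
have E0 : (0 <= E)%E by apply: esum_ge0 => n _; rewrite lee_fin powR_ge0.
have h : (E <= (s `^ p)%:E)%E.
  by apply: esum_le_fin => l ul; apply: ((nle_sumP p_ge1 0 f s0).1 hs).
rewrite -lee_fin fineK// ge0_fin_numE//; exact: le_lt_trans h (ltry _).
Qed.

(** Continuous inclusion of l^p(Z, omega_k) in l^1(Z), the form in which the two cases for [a] and
    [p] enter the proof. *)
Definition l1_embedded k := exists C : R, 0 <= C /\
  forall s f, nle p k s f -> nle 1 0 (C * s) f.

(** Hölder's inequality, from x y <= x^p / p + y^q / q with q the conjugate exponent, x the weighted
    modulus divided by [s] and y = 1 / max(1, |n|). The sum of the y^q is at most [Z] because q > 1,
    and k > 0 gives max(1, |n|) <= [wt R k n]. *)
Lemma l1_embedded_gt1 k : 1 < p -> (0 < k)%N -> l1_embedded k.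
Proof.
move=> p1 k0; pose q := p / (p - 1).
have pm : 0 < p - 1 by rewrite subr_gt0.
have q1 : 1 < q by rewrite /q ltr_pdivlMr// mul1r gtrBl.
have q0 : 0 < q by rewrite (lt_trans _ q1).
have pq : p^-1 + q^-1 = 1 by rewrite /q; field; rewrite !gt_eqF.
have [Z [Z0 hZ]] := riemann_bounded q1.
have C0 : 0 <= p^-1 + Z / q.
  by apply: addr_ge0; [rewrite invr_ge0 ltW|apply: divr_ge0 => //; exact: ltW].
exists (p^-1 + Z / q); split=> // s f h; have s0 := nle_ge0 h.
have [s00|sn0] := eqVneq s 0.
  rewrite s00 in h *; rewrite (nle0_eq0 p_ge1 h) mulr0.
  exact: nle_zero.
have {sn0} sp : 0 < s by rewrite lt0r sn0.
apply/l1P; split=> [|l ul]; first by rewrite mulr_ge0.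
have key n : cmod (f n) / s <= (cmod (f n) * wt R k n) `^ p * ((s `^ p)^-1 / p) +
     (Num.max 1 (`|n|%:~R : R)) `^ (- q) / q.
  have m0 : 0 < Num.max 1 (`|n|%:~R : R) by rewrite lt_max ltr01.
  have mw : Num.max 1 (`|n|%:~R : R) <= wt R k n.
    by apply: le_trans (wt_mono R n k0); rewrite /wt expr1.
  have a0 : 0 <= cmod (f n) * wt R k n by rewrite mulr_ge0 ?cmod_ge0 ?wt_ge0.
  have sV : 0 <= s^-1 by rewrite invr_ge0.
  have := @conjugate_powR R (cmod (f n) * wt R k n * s^-1)
    (Num.max 1 (`|n|%:~R : R))^-1 p q.
  rewrite mulr_ge0// invr_ge0 (ltW m0) => /(_ isT isT p_gt0 q0 pq).
  rewrite powRM// -[in X in _ <= _ * X / _ + _]powR_inv1// -powRrM mulN1r.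
  rewrite -[in X in _ <= _ + X / _]powR_inv1 ?(ltW m0)// -powRrM mulN1r => hh.
  rewrite [X in _ <= X + _]mulrA -!powRN; apply: le_trans hh.
  rewrite (_ : _ * _ * _ * _ = cmod (f n) / s * (wt R k n / Num.max 1 `|n|%:~R)); last by ring.
  rewrite ler_peMr ?divr_ge0 ?cmod_ge0//.
  by rewrite ler_pdivlMr// mul1r.
rewrite -ler_pdivrMr// mulr_suml.
apply: (le_trans (ler_sum _ (fun n _ => key n))).
rewrite big_split /= -!mulr_suml lerD//.
  rewrite mulrA ler_pdivrMr// mulVf ?gt_eqF// ler_pdivrMr ?powR_gt0// mul1r.
  by apply: ((nle_sumP p_ge1 k f s0).1 h).
by rewrite ler_wpM2r ?invr_ge0 ?(ltW q0)// hZ.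
Qed.

End Membership.

Lemma l1_embedded_1 (R : realType) k : l1_embedded (1 : R) k.
Proof. by exists 1; split=> // s f; rewrite mul1r; apply: nle_mono. Qed.

(** * Characters of l^1(Z) at points of the unit circle *)

Definition chi {R : realType} (z : R[i]) (f : int -> R[i]) : R[i] :=
  zsum (fun n => f n * z ^ n).

Section Characters.
Variables (R : realType).
Implicit Types (f g : int -> R[i]) (s t : R) (z : R[i]).

Lemma cmod_exprz z (n : int) : cmod z = 1 -> cmod (z ^ n) = 1.
Proof.
move=> z1.
have E m : cmod (z ^+ m) = 1.
  by elim: m => [|m IH]; rewrite ?expr0 ?cmod1// exprS cmodM z1 IH mulr1.
by case: n => m; rewrite ?NegzE ?exprnN ?cmodV -?exprnP E ?invr1.
Qed.

Lemma cmod1_neq0 z : cmod z = 1 -> z != 0.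
Proof. by move=> z1; apply/eqP => z0; move: z1; rewrite z0 cmod0 => /eqP; rewrite eq_sym oner_eq0. Qed.

Lemma chi_has z f s : cmod z = 1 -> nle 1 0 s f ->
  has_zsum (fun n => f n * z ^ n) (chi z f).
Proof.
move=> z1 hf; apply: (@l1_has_zsum _ s); apply: nle_le hf => // n.
by rewrite cmodM cmod_exprz// mulr1.
Qed.

Lemma cmod_chi z f s : cmod z = 1 -> nle 1 0 s f -> cmod (chi z f) <= s.
Proof.
move=> z1 hf; apply: cmod_zsum; apply: nle_le hf => // n.
by rewrite cmodM cmod_exprz// mulr1.
Qed.

Lemma chi_lin z (c : R[i]) f g s t : cmod z = 1 -> nle 1 0 s f -> nle 1 0 t g ->
  chi z (fun n => c * f n + g n) = c * chi z f + chi z g.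
Proof.
move=> z1 hf hg; apply: has_zsumE.
have := has_zsum_lin c (chi_has z1 hf) (chi_has z1 hg).
by congr has_zsum; apply/funext => n; ring.
Qed.

Lemma chi_delta z k : chi z (delta k) = z ^ k.
Proof. exact: has_zsumE (has_zsum_delta k (fun n => z ^ n)). Qed.

Lemma chi_shift z g s k : cmod z = 1 -> nle 1 0 s g ->
  chi z (fun n => g (n - k)) = z ^ k * chi z g.
Proof.
move=> z1 hg; apply: has_zsumE.
have K : cancel (fun n : int => n - k) (fun n => n + k) by move=> n; rewrite subrK.
have := has_zsum_reindex K (fun n => _) (chi_has z1 hg) => /(_ _)/wrap[n|].
  by rewrite addrK eqxx.
move=> /(has_zsum_lin (z ^ k)) /(_ (has_zsum_zero (fun=> erefl))).
rewrite addr0; congr has_zsum; apply/funext => n.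
by rewrite addr0 mulrCA -expfzDr ?cmod1_neq0// subrKC.
Qed.

(** Both sides are linear and l^1-continuous in [f], which reduces the claim to unit masses, where
    convolution is a translation. *)
Lemma chi_conv z f g s t : cmod z = 1 -> nle 1 0 s f -> nle 1 0 t g ->
  chi z (conv f g) = chi z f * chi z g.
Proof.
move=> z1 hf hg.
have bg n : cmod (g n) <= t by exact: nle_cmod hg.
have t0 := nle_ge0 hg.
have fin l : uniq l -> chi z (conv (trunc l f) g) = chi z (trunc l f) * chi z g.
  elim: l => [_|k l IH /= /andP[kl ul]].
    have -> : trunc [::] f = (fun=> 0) by apply/funext.
    have -> : conv (fun=> 0) g = (fun=> 0).
      by apply/funext => n; apply/has_zsumE/has_zsum_zero => k; rewrite mul0r.
    have -> : chi z (fun=> 0) = 0.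
      by apply/has_zsumE/has_zsum_zero => k; rewrite mul0r.
    by rewrite mul0r.
  have [s' hs'] := nle_trunc_ex (lexx 1) 0 f ul.
  have hd := nle_delta (lexx (1 : R)) 0 k.
  rewrite trunc_cons// (conv_linl _ hd hs' bg).
  rewrite (chi_lin _ z1 (young (lexx 1) hd hg) (young (lexx 1) hs' hg)).
  rewrite (chi_lin _ z1 hd hs') IH// chi_delta.
  rewrite (funext (conv_delta k g)) (chi_shift _ z1 hg); ring.
apply/eqP; rewrite -subr_eq0; apply/eqP/cmod_eq0/eqP; rewrite eq_le cmod_ge0 andbT.
apply/ler_addgt0Pr => e e0; rewrite add0r.
(* The tail of [f] enters both sides, each time multiplied by at most [t]; t + 1 avoids dividing by
   zero. *)
have d0 : 0 < e / (2 * (t + 1)) by rewrite divr_gt0// mulr_gt0// ltr_pwDr.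
have [N /(_ _ (leqnn N)) hN] := nle_tail (lexx 1) hf d0.
set d := _ / _ in d0 hN.
pose h n := f n - trunc (win N) f n.
have hT := nle_trunc (lexx 1) (win N) hf.
have fE : f = (fun n => 1 * h n + trunc (win N) f n).
  by apply/funext => n; rewrite mul1r subrK.
rewrite [X in cmod (chi z (conv X g) - _)]fE [X in cmod (_ - chi z X * _)]fE.
rewrite (conv_linl _ hN hT bg).
rewrite (chi_lin _ z1 (young (lexx 1) hN hg) (young (lexx 1) hT hg)).
rewrite (chi_lin _ z1 hN hT) fin ?win_uniq// !mul1r mulrDl opprD addrACA subrr addr0.
apply: le_trans (cmodB _ _) _; rewrite cmodM.
have h1 := cmod_chi z1 (young (lexx 1) hN hg).
have h2 := cmod_chi z1 hN; have h3 := cmod_chi z1 hg.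
apply: le_trans (lerD h1 (ler_pM (cmod_ge0 _) (cmod_ge0 _) h2 h3)) _.
apply: (@le_trans _ _ (d * (2 * (t + 1)))).
  by rewrite -mulrDr ler_wpM2l ?(ltW d0)//; lra.
by rewrite /d divfK// gt_eqF// mulr_gt0// ltr_pwDr.
Qed.

End Characters.

(** * Recovering coefficients from the values of the characters *)

Section FourierCoefficients.
Variables (R : realType).
Implicit Types (f g : int -> R[i]) (s t : R) (z : R[i]).

Let half_exprz z (n : int) : z != 0 -> (z ^ n + (- z) ^ n) / 2 = if (2 %| n)%Z then z ^ n else 0.
Proof.
move=> z0; have E (x : R[i]) (m : int) : (- x) ^ (m * 2) = x ^ (m * 2).
  by rewrite ![m * 2]mulrC -!exprz_exp -!exprnP sqrrN.
case: ifPn => [/dvdzP[m ->]|n2]; first by rewrite E; field.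
have -> : n = (n %/ 2)%Z * 2 + 1.
  by rewrite {1}(divz_eq n 2); congr (_ + _); move: n2; rewrite dvdzE /=; lia.
by rewrite !expfzDr ?oppr_eq0// E !expr1z; field.
Qed.

Lemma nle_inj_reindex s f (h : int -> int) : injective h -> nle 1 0 s f ->
  nle 1 0 s (fun n => f (h n)).
Proof.
move=> hi /l1P[s0 hf]; apply/l1P; split=> // l ul.
by have := hf (map h l); rewrite map_inj_uniq// big_map; apply.
Qed.

Lemma chi_even z f s : cmod z = 1 -> nle 1 0 s f ->
  chi (z ^+ 2) (fun n => f (n * 2)) = (chi z f + chi (- z) f) / 2.
Proof.
move=> z1 hf; have z1' : cmod (- z) = 1 by rewrite cmodN.
apply: has_zsumE.
have h1 := has_zsum_lin 1 (chi_has z1 hf) (chi_has z1' hf).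
have := has_zsum_lin (2^-1) h1 (has_zsum_zero (fun=> erefl)).
have K : cancel (fun n : int => n * 2) (fun n => (n %/ 2)%Z) by move=> n; rewrite mulzK.
move=> /(has_zsum_reindex K (fun n => _)) => /(_ _)/wrap[n nE|].
  have := half_exprz n (cmod1_neq0 z1); rewrite dvdz_eq (negPf nE) => h.
  rewrite mul1r -mulrDr mulrCA mulrC [2^-1 * _]mulrC h; ring.
rewrite !mul1r addr0 mulrC; congr has_zsum; apply/funext => n.
have := half_exprz (n * 2) (cmod1_neq0 z1); rewrite dvdz_mull// => h.
rewrite exprnP exprz_exp (mulrC 2) -[in RHS]h mul1r addr0 -mulrDr mulrCA; congr (_ * _).
by rewrite mulrC.
Qed.

(* Averaging [chi] over [z] and [- z] keeps the even coefficients only, so passing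
   to [f (2 n)] does not increase the supremum of [|chi_z f|] over the circle. *)
Lemma chi_dilate s f (B : R) m : nle 1 0 s f ->
  (forall z, cmod z = 1 -> cmod (chi z f) <= B) ->
  forall z, cmod z = 1 -> cmod (chi z (fun n => f (n * (2 ^+ m)))) <= B.
Proof.
elim: m f => [|m IH] f hf hB z z1.
  rewrite (_ : (fun n => _) = f) ?hB//.
  by apply/funext => n; rewrite expr0 mulr1.
have h1 : nle 1 0 s (fun n => f (n * 2)).
  by apply: nle_inj_reindex hf => i j; lia.
have h2 w : cmod w = 1 -> cmod (chi w (fun n => f (n * 2))) <= B.
  move=> w1.
  have x1 : cmod (sqrtc w) = 1.
    apply/eqP; rewrite -sqrp_eq1 ?cmod_ge0// expr2 -cmodM -expr2 sqr_sqrtc.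
    by rewrite w1.
  rewrite -(sqr_sqrtc w) (chi_even x1 hf).
  rewrite cmodM cmodV.
  have -> : cmod (2 : R[i]) = 2.
    by rewrite -[2]/(2%:~R) cmod_int.
  rewrite ler_pdivrMr// (le_trans (cmodD _ _))// mulr_natr mulr2n lerD ?hB//.
  by rewrite cmodN.
have -> : (fun n => f (n * 2 ^+ m.+1)) = (fun n => f (n * 2 ^+ m * 2)).
  by apply/funext => n; rewrite exprSr mulrA.
exact: (IH _ h1 h2 z z1).
Qed.

(** Dilation replaces the integral over the circle. Since 2^N > N, the indices n * 2^N with n
    nonzero leave the window of radius N, so the dilated sequence is f_0 e_0 up to a tail of l^1
    norm at most e. *)
Lemma coef0_le s f (B : R) : nle 1 0 s f ->
  (forall z, cmod z = 1 -> cmod (chi z f) <= B) -> cmod (f 0) <= B.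
Proof.
move=> hf hB; apply/ler_addgt0Pr => e e0.
have [N /(_ _ (leqnn N)) hN] := nle_tail (lexx 1) hf e0.
have := chi_dilate N hf hB (cmod1 R).
pose t n := f n - trunc (win N) f n.
have hi : injective (fun n : int => n * 2 ^+ N).
  by apply: mulIf; rewrite expf_neq0.
have ht : nle 1 0 e (fun n => t (n * 2 ^+ N)) by exact: nle_inj_reindex hN.
rewrite (_ : (fun n => _) = (fun n => f 0 * delta 0 n + t (n * 2 ^+ N))); last first.
  apply/funext => n; rewrite /t /trunc /delta mem_win.
  have [->|n0] := eqVneq n 0; first by rewrite mul0r /= subrr addr0 mulr1.
  rewrite mulr0 add0r ifN ?subr0// -ltnNge abszM abszX /=.
  by rewrite (leq_trans (ltn_expl N (ltnSn 1)))// leq_pmull// absz_gt0.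
rewrite (chi_lin _ (cmod1 R) (nle_delta (lexx 1) 0 0) ht) chi_delta expr0z mulr1 => h.
have h2 := cmod_chi (cmod1 R) ht.
have -> : f 0 = (f 0 + chi 1 (fun n => t (n * 2 ^+ N))) - chi 1 (fun n => t (n * 2 ^+ N)) by ring.
by apply: le_trans (cmodB _ _) _; rewrite lerD.
Qed.

(** A translation brings index n to 0 and multiplies each character by a number of modulus 1. *)
Lemma coef_le s f (B : R) n : nle 1 0 s f ->
  (forall z, cmod z = 1 -> cmod (chi z f) <= B) -> cmod (f n) <= B.
Proof.
move=> hf hB.
have -> : f n = (fun m => f (m - (- n))) 0 by rewrite opprK add0r.
apply: (coef0_le (nle_shift (- n) hf)) => z z1.
by rewrite (chi_shift _ z1 hf) cmodM cmod_exprz// mul1r hB.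
Qed.

Lemma chi_inj s t f g : nle 1 0 s f -> nle 1 0 t g ->
  (forall z, cmod z = 1 -> chi z f = chi z g) -> f = g.
Proof.
move=> hf hg h; apply/funext => n; apply/eqP; rewrite -subr_eq0; apply/eqP/cmod_eq0/eqP.
have hd := nle_lin (lexx 1) (-1) hg hf.
rewrite eq_le cmod_ge0 andbT addrC -mulN1r.
apply: (coef_le n hd) => z z1.
by rewrite (chi_lin _ z1 hg hf) h// mulN1r addNr cmod0.
Qed.

End FourierCoefficients.

(** * The weighted spaces as Banach algebras *)

Definition lpw {R : realType} (p : R) (k : nat) (f : int -> R[i]) := exists s, nle p k s f.

Section BanachAlgebra.
Variables (R : realType) (p : R) (k : nat).
Hypothesis p_ge1 : 1 <= p.
Hypothesis emb : l1_embedded p k.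
Implicit Types (f g : int -> R[i]) (s t : R).

Lemma lpw_lin (c : R[i]) f g : lpw p k f -> lpw p k g -> lpw p k (fun n => c * f n + g n).
Proof. by move=> [s hs] [t ht]; eexists; apply: nle_lin hs ht. Qed.

Lemma lpw_zero : lpw p k (fun=> 0).
Proof. by exists 0; apply: nle_zero. Qed.

Lemma lpw_l1 f : lpw p k f -> exists s, nle 1 0 s f.
Proof. by move=> [s hs]; have [C [_ hC]] := emb; exists (C * s); apply: hC. Qed.

Lemma conv_bounded : exists K, 0 < K /\ forall f g s t, nle p k s f -> nle p k t g ->
  nle p k (K * s * t) (conv f g).
Proof.
have [C [C0 hC]] := emb; exists (2 ^+ k * (2 * C) + 1); split.
  by rewrite ltr_pwDr// mulr_ge0 ?exprn_ge0// mulr_ge0.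
move=> f g s t hf hg; have s0 := nle_ge0 hf; have t0 := nle_ge0 hg.
apply: nle_weaken (nle_conv p_ge1 hf hg (hC _ _ hf) (hC _ _ hg)).
have -> : 2 ^+ k * (s * (C * t) + C * s * t) = 2 ^+ k * (2 * C) * s * t by ring.
by rewrite -[leLHS]mulrA -[leRHS]mulrA ler_wpM2r ?mulr_ge0// lerDl.
Qed.

Lemma lpw_conv f g : lpw p k f -> lpw p k g -> lpw p k (conv f g).
Proof.
by have [K [_ hK]] := conv_bounded => -[s hs] [t ht]; eexists; apply: hK hs ht.
Qed.

(** The solution is the sum of the powers of [r], found as the fixed point of x -> r + r * x, which
    contracts distances by the factor 1/2. Written this way it involves no unit. *)
Lemma neumann K : 0 < K ->
  (forall f g s t, nle p k s f -> nle p k t g -> nle p k (K * s * t) (conv f g)) ->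
  forall r t, nle p k t r -> K * t <= 2^-1 ->
  exists2 x, lpw p k x & x = (fun n => r n + conv r x n).
Proof.
move=> K0 hK r t hr Kt; have t0 := nle_ge0 hr.
have [C [C0 hC]] := emb.
have r1 := hC _ _ hr.
have bd f s : nle p k s f -> forall n, cmod (f n) <= s by move=> h n; apply: nle_cmod h.
pose u := fix u i : int -> R[i] := if i is j.+1 then fun n => r n + conv r (u j) n else fun=> 0.
have hu i : nle p k (2 * t) (u i).
  elim: i => [|i IH]; first by apply: nle_weaken (nle_zero p_ge1 k); rewrite mulr_ge0.
  apply: nle_weaken (nle_add p_ge1 hr (hK _ _ _ _ hr IH)).
  have : K * t * (2 * t) <= 2^-1 * (2 * t) by rewrite ler_wpM2r// mulr_ge0.
  lra.
have conv_sub f g s s' : nle p k s f -> nle p k s' g ->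
    conv r (fun n => f n - g n) = (fun n => conv r f n - conv r g n).
  move=> hf hg; have := conv_linr (-1) r1 (bd _ _ hg) (bd _ _ hf).
  rewrite (_ : (fun n => _) = (fun n => f n - g n)) => [->|]; last first.
    by apply/funext => n; ring.
  by apply/funext => n; ring.
have [i|x hx] := @nle_geometric _ _ p_ge1 k t u.
  elim: i => [|i IH].
    rewrite expr0 divr1; apply: nle_le hr => // n /=; rewrite subr0.
    have -> : conv r (fun=> 0) n = 0.
      by apply/has_zsumE/has_zsum_zero => j; rewrite mulr0.
    by rewrite addr0.
  have := hK _ _ _ _ hr IH; rewrite (conv_sub _ _ _ _ (hu _) (hu _)).
  rewrite (_ : (fun n => _) = (fun n => u i.+2 n - u i.+1 n)); last first.
    by apply/funext => n /=; ring.
  apply: nle_weaken; rewrite exprS invfM [leRHS]mulrCA ler_wpM2r//.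
  by rewrite divr_ge0 ?exprn_ge0.
have hx0 : nle p k (2 * t) x.
  by have := hx 0%N; rewrite expr0 divr1; apply: nle_le => // n; rewrite subr0.
exists x; first by exists (2 * t).
apply/funext => n; apply/eqP; rewrite -subr_eq0; apply/eqP/cmod_eq0/eqP.
rewrite eq_le cmod_ge0 andbT; apply/ler_addgt0Pr => e e0; rewrite add0r.
have t4 : 0 <= 4 * t by rewrite mulr_ge0.
have [i hi] := geometric_small t4 e0; apply: le_trans hi.
have -> : x n - (r n + conv r x n) = (x n - u i.+1 n) - (conv r x n - conv r (u i) n).
  by rewrite /=; ring.
apply: le_trans (cmodB _ _) _.
have h1 := nle_cmod p_ge1 n (hx i.+1).
have := nle_cmod p_ge1 n (hK _ _ _ _ hr (hx i)); rewrite (conv_sub _ _ _ _ hx0 (hu _)) => h2.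
apply: le_trans (lerD h1 h2) _.
have P2 : 0 < 2 ^+ i :> R by rewrite exprn_gt0.
have q0 : 0 <= t / 2 ^+ i by rewrite divr_ge0// ltW.
have : K * t * (2 * (t / 2 ^+ i)) <= 2^-1 * (2 * (t / 2 ^+ i)) by rewrite ler_wpM2r// mulr_ge0.
rewrite exprS invfM -!mulrA [t * (2^-1 * _)]mulrCA; move: (t / _) q0 => q q0; lra.
Qed.

End BanachAlgebra.

(** * Automatic continuity of algebra homomorphisms *)

Section AutomaticContinuity.
Variables (R : realType) (p : R) (k : nat).
Hypothesis p_ge1 : 1 <= p.
Hypothesis emb : l1_embedded p k.
Variable T : (int -> R[i]) -> (int -> R[i]).
Hypothesis T_mem : forall f, lpw p k f -> lpw p k (T f).
Hypothesis T_lin : forall (c : R[i]) f g, lpw p k f -> lpw p k g ->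
  T (fun n => c * f n + g n) = (fun n => c * T f n + T g n).
Hypothesis T_conv : forall f g, lpw p k f -> lpw p k g -> T (conv f g) = conv (T f) (T g).
Implicit Types (f g : int -> R[i]) (s t : R).

Lemma T_zero : T (fun=> 0) = (fun=> 0).
Proof.
have := T_lin (-1) (lpw_zero k p_ge1) (lpw_zero k p_ge1).
rewrite (_ : (fun n => _) = (fun=> 0)); last by apply/funext => n; rewrite mulr0 addr0.
by move=> ->; apply/funext => n; rewrite mulN1r addNr.
Qed.

Lemma T_sub f g : lpw p k f -> lpw p k g ->
  T (fun n => f n - g n) = (fun n => T f n - T g n).
Proof.
move=> hf hg; rewrite (_ : (fun n => f n - _) = (fun n => -1 * g n + f n)); last first.
  by apply/funext => n; ring.
by rewrite T_lin//; apply/funext => n; ring.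
Qed.

Lemma T_scale (c : R[i]) f : lpw p k f -> T (fun n => c * f n) = (fun n => c * T f n).
Proof.
move=> hf; rewrite (_ : (fun n => c * f n) = (fun n => c * f n + (fun=> 0) n)); last first.
  by apply/funext => n; rewrite addr0.
rewrite (T_lin c hf (lpw_zero k p_ge1)) T_zero.
by apply/funext => n; rewrite addr0.
Qed.

(* A character of a Banach algebra is bounded: if [c = chi (T f)] were large,
   the Neumann series [x] of [f / c] would satisfy [chi (T x) = 1 + chi (T x)]. *)
Lemma chi_T_bounded : exists K, 0 < K /\ forall f t z, cmod z = 1 -> nle p k t f ->
  cmod (chi z (T f)) <= K * t.
Proof.
have [K [K0 hK]] := conv_bounded p_ge1 emb.
(* If the bound with 2 K fails, then [K] times the norm of f / c is at most 1/2, as [neumann]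
   requires. *)
exists (2 * K); split=> [|f t z z1 hf]; first by rewrite mulr_gt0.
rewrite leNgt; apply/negP => hc.
have t0 := nle_ge0 hf.
set c := chi z (T f) in hc.
have c0 : 0 < cmod c by apply: le_lt_trans hc; rewrite !mulr_ge0// ltW.
have cn0 : c != 0 by apply: contraTneq c0 => ->; rewrite cmod0 ltxx.
have hr := nle_scale p_ge1 (c^-1) hf.
have [|x hx xE] := neumann p_ge1 emb K0 hK hr.
  rewrite cmodV mulrCA ler_pdivrMl// ler_pdivlMr// mulrC.
  by rewrite mulrA ltW.
have mr : lpw p k (fun n => c^-1 * f n) by eexists; exact: hr.
have mrx := lpw_conv p_ge1 emb mr hx.
have Tx : T x = (fun n => 1 * T (fun n => c^-1 * f n) n + conv (T (fun n => c^-1 * f n)) (T x) n).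
  rewrite -T_conv// -T_lin// {1}xE; congr T.
  by apply/funext => n; rewrite mul1r.
have [s1 l1] := lpw_l1 emb (T_mem mr).
have [s2 l2] := lpw_l1 emb (T_mem hx).
have [s3 l3] : exists s, nle 1 0 s (T f) by apply/(lpw_l1 emb)/T_mem; exists t.
have l12 := young (lexx 1) l1 l2.
have := congr1 (chi z) Tx.
rewrite (chi_lin _ z1 l1 l12) (chi_conv z1 l1 l2) mul1r.
have -> : chi z (T (fun n => c^-1 * f n)) = 1.
  rewrite T_scale; last by exists t.
  have l0 : nle (1 : R) 0 0 (fun=> 0 : R[i]) := nle_zero (lexx 1) 0.
  have := chi_lin (c^-1) z1 l3 l0.
  rewrite (_ : (fun n => _ + _) = (fun n => c^-1 * T f n)); last first.
    by apply/funext => n; rewrite addr0.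
  move=> ->; rewrite -/c mulVf// (_ : chi z _ = 0) ?addr0//.
  by apply/has_zsumE/has_zsum_zero => n; rewrite mul0r.
rewrite mul1r => /eqP; rewrite -subr_eq0 opprD addrCA subrr addr0 oppr_eq0.
by rewrite oner_eq0.
Qed.

Lemma coef_T_bounded : exists K, 0 < K /\ forall f t n, nle p k t f ->
  cmod (T f n) <= K * t.
Proof.
have [K [K0 hK]] := chi_T_bounded; exists K; split=> // f t n hf.
have [s hs] : exists s, nle 1 0 s (T f) by apply/(lpw_l1 emb)/T_mem; exists t.
by apply: (coef_le n hs) => z z1; apply: hK.
Qed.

(* The sets [{f | ||T f|| <= i}] are closed since the coefficients of [T f]
   depend continuously on [f]; were [T] unbounded, nested balls avoiding them
   one after the other would contain a common [f]. *)
Lemma T_bounded : exists C, 0 <= C /\ forall f s, nle p k s f -> nle p k (C * s) (T f).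
Proof.
have [K [K0 hK]] := coef_T_bounded.
apply: contrapT => unb.
(* By homogeneity, an unbounded [T] is unbounded on every ball around 0. *)
have big e M : 0 < e -> exists2 y, nle p k e y & ~ nle p k M (T y).
  move=> e0; apply: contrapT => h; apply: unb.
  have hM y : nle p k e y -> nle p k M (T y).
    by move=> hy; apply: contrapT => h'; apply: h; exists y.
  have M0 : 0 <= M.
    have := hM (fun=> 0) (nle_weaken (ltW e0) (nle_zero p_ge1 k)).
    exact: nle_ge0.
  exists (M / e); split=> [|f s hf]; first by rewrite divr_ge0// ltW.
  have s0 := nle_ge0 hf.
  have [s00|sn0] := eqVneq s 0.
    rewrite s00 in hf *; rewrite (nle0_eq0 p_ge1 hf) mulr0 T_zero.
    exact: nle_zero.
  have sp : 0 < s by rewrite lt0r sn0.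
  have es0 : 0 < e / s by rewrite divr_gt0.
  pose c : R[i] := (e / s)%:C%C.
  have cE : cmod c = e / s by rewrite cmod_real ger0_norm// ltW.
  have cn0 : c != 0.
    by apply: contraTneq es0 => c00; rewrite -cE c00 cmod0 ltxx.
  have := hM (fun n => c * f n).
  rewrite T_scale; last by exists s.
  move=> /(_ _)/wrap[|/(nle_scale p_ge1 (c^-1))].
    by have := nle_scale p_ge1 c hf; rewrite cE divfK// gt_eqF.
  rewrite cmodV cE invf_div (_ : s / e * M = M / e * s); last by ring.
  rewrite (_ : (fun n => _) = T f); first by [].
  by apply/funext => n; rewrite mulKf.
have step x e i : lpw p k x -> 0 < e -> exists x' e', [/\ lpw p k x', 0 < e', e' <= e / 2,
    nle p k (e / 2) (fun n => x' n - x n) &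
    forall z, nle p k e' (fun n => z n - x' n) -> ~ nle p k i (T z)].
  move=> mx e0; have e2 : 0 < e / 2 by rewrite divr_gt0.
  have [M0 hM0] := T_mem mx.
  have [y hy Ty] := big (e / 2) (i + M0) e2.
  have my : lpw p k y by exists (e / 2).
  pose x' n := 1 * x n + y n.
  have mx' : lpw p k x' by apply: lpw_lin.
  (* The image of [y] exceeds i + M0 in norm, and that of [x] is at most [M0]. *)
  have Tx' : ~ nle p k i (T x').
    have TE : T x' = (fun n => 1 * T x n + T y n) := T_lin 1 mx my.
    move=> h; apply: Ty; have := nle_sub p_ge1 h hM0; rewrite TE => h'.
    have -> : T y = (fun n => 1 * T x n + T y n - T x n).
      by apply/funext => n; ring.
    exact: h'.
  (* Were no radius suitable, there would be points tending to x' with images of norm at most [i];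
     the coefficients of these images converge, so [nle_lim] would bound the image of x' by [i]. *)
  have [e' [e'0 e'e he']] : exists e', [/\ 0 < e', e' <= e / 2 &
      forall z, nle p k e' (fun n => z n - x' n) -> ~ nle p k i (T z)].
    apply: contrapT => h; apply: Tx'.
    have P2 j : 0 < 2 ^+ j :> R by rewrite exprn_gt0.
    have /choice[z hz] j : exists z, nle p k (e / 2 / 2 ^+ j) (fun n => z n - x' n) /\
        nle p k i (T z).
      apply: contrapT => hj; apply: h; exists (e / 2 / 2 ^+ j); split.
      - by rewrite divr_gt0.
      - by rewrite ler_pdivrMr// ler_peMr ?(ltW e2)// exprn_ege1// ler1n.
      - by move=> z hz hTz; apply: hj; exists z.
    apply: (nle_lim p_ge1 (u := fun j => T (z j))).
      by exists 0%N => j _; case: (hz j).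
    move=> n d d0.
    have [N hN] := geometric_small (ltW (mulr_gt0 K0 e2)) d0.
    exists N => j Nj; apply: le_trans hN.
    have [hzj _] := hz j.
    have mzj : lpw p k (z j).
      have [s hs] := mx'; eexists.
      have h' := nle_add p_ge1 hzj hs.
      have -> : z j = (fun n => z j n - x' n + x' n).
        by apply/funext => m; rewrite subrK.
      exact: h'.
    have := hK _ _ n hzj; rewrite T_sub// => /le_trans; apply.
    rewrite mulrA ler_wpM2l//; first by rewrite ltW// mulr_gt0.
    by rewrite lef_pV2 ?posrE// ler_weXn2l// ler1n.
  exists x', e'; split; [exact: mx'|exact: e'0|exact: e'e| |exact: he'].
  by apply: nle_le hy => // n; rewrite /x' mul1r addrAC subrr add0r.
(* A state is a closed ball, given by centre and radius; the index paired with it is the bound that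
   the images of the next ball must exceed. *)
pose St := ((int -> R[i]) * R)%type.
have /choice[nxt hnxt] (a : St * nat) : exists b : St, lpw p k a.1.1 -> 0 < a.1.2 ->
    [/\ lpw p k b.1, 0 < b.2, b.2 <= a.1.2 / 2,
     nle p k (a.1.2 / 2) (fun n => b.1 n - a.1.1 n) &
     forall z, nle p k b.2 (fun n => z n - b.1 n) -> ~ nle p k a.2%:R (T z)].
  case: a => -[x e] i /=.
  have [[mx e0]|h] := pselect (lpw p k x /\ 0 < e).
    by have [x' [e' h]] := step x e i%:R mx e0; exists (x', e').
  by exists (x, e) => mx e0; case: h.
pose S := fix S i : St := if i is j.+1 then nxt (S j, j) else (fun=> 0, 1).
have S0 i : lpw p k (S i).1 /\ 0 < (S i).2.
  elim: i => [|i [m e]]; first by split=> //; apply: lpw_zero.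
  by have [] := hnxt (S i, i) m e.
have hS i := hnxt (S i, i) (S0 i).1 (S0 i).2.
(* Centres at distance at most the difference of the radii: this expresses that the balls are
   nested. *)
have nest i m : nle p k ((S i).2 - (S (i + m)%N).2) (fun n => (S (i + m)%N).1 n - (S i).1 n).
  elim: m => [|m IH].
    rewrite addn0 subrr (_ : (fun n => _) = (fun=> 0)); first exact: nle_zero.
    by apply/funext => n; rewrite subrr.
  have [_ _ h1 h2 _] := hS (i + m)%N; rewrite addnS /=.
  have := nle_add p_ge1 h2 IH => /=.
  rewrite (_ : (fun n => _) = (fun n => (nxt (S (i + m)%N, (i + m)%N)).1 n - (S i).1 n)); last first.
    by apply/funext => n; ring.
  by apply: nle_weaken; move: h1 => /=; lra.
have Se i : (S i).2 <= 1 / 2 ^+ i.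
  elim: i => [|i IH]; first by rewrite expr0 divr1.
  have [_ _ h _ _] := hS i; apply: le_trans h _ => /=.
  by rewrite exprS invfM mulrCA mulrC ler_wpM2l.
have [i|f hf] := @nle_geometric _ _ p_ge1 k (2^-1) (fun i => (S i).1).
  have [_ _ _ h _] := hS i; apply: nle_weaken h.
  by rewrite /= mulrC ler_wpM2l//; have := Se i; rewrite div1r.
have ball i : nle p k (S i).2 (fun n => f n - (S i).1 n).
  apply: (nle_lim p_ge1 (u := fun j n => (S j).1 n - (S i).1 n)).
    exists i => j ij; rewrite -(subnKC ij); apply: nle_weaken (nest i (j - i)%N).
    by rewrite gerBl ltW//; case: (S0 (i + (j - i))%N).
  move=> n d d0; have [N hN] := geometric_small ler01 d0.
  exists N => j Nj; apply: le_trans hN.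
  have -> : (S j).1 n - (S i).1 n - (f n - (S i).1 n) = (S j).1 n - f n by ring.
  rewrite cmodBC; apply: le_trans (nle_cmod p_ge1 n (hf j)) _.
  rewrite divff// ler_wpM2l// lef_pV2 ?posrE ?exprn_gt0//.
  by rewrite ler_weXn2l// ler1n.
have [M hM] : lpw p k (T f).
  apply: T_mem; exists (S 0).2; apply: nle_le (ball 0%N) => // n /=.
  by rewrite subr0.
(* The common point [f] lies in the ball of index [Num.bound M] + 1, where images of norm at most
   [Num.bound M] are excluded, although [T f] has norm at most [M]. *)
have [_ _ _ _ /(_ f)] := hS (Num.bound M).
apply; first exact: (ball (Num.bound M).+1).
have M0 := nle_ge0 hM.
by apply: nle_weaken hM; apply/ltW/archi_boundP.
Qed.

End AutomaticContinuity.

(** * The derivation and its effect on weights *)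

Definition dmul {R : realType} (f : int -> R[i]) (n : int) : R[i] := n%:~R * f n.

Section Derivation.
Variables (R : realType) (p : R).
Hypothesis p_ge1 : 1 <= p.
Implicit Types (f g : int -> R[i]) (s t : R).

Lemma nle_dmul j s f : nle p j.+1 s f -> nle p j s (dmul f).
Proof.
apply: nle_le => // n; rewrite /dmul cmodM cmod_int mulrAC mulrC.
by rewrite ler_wpM2l ?cmod_ge0 ?wt_norm_le.
Qed.

Lemma dmul_lin (c : R[i]) f g :
  dmul (fun n => c * f n + g n) = (fun n => c * dmul f n + dmul g n).
Proof. by apply/funext => n; rewrite /dmul; ring. Qed.

Lemma dmul_trunc l f : dmul (trunc l f) = trunc l (dmul f).
Proof. by apply/funext => n; rewrite /dmul /trunc; case: ifP => // _; rewrite mulr0. Qed.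

(** Leibniz' rule, from n = j + (n - j) under the convolution sum. *)
Lemma dmul_conv f g s t s' t' : nle 1 0 s f -> nle 1 0 t g ->
  nle 1 0 s' (dmul f) -> nle 1 0 t' (dmul g) ->
  dmul (conv f g) = (fun n => 1 * conv (dmul f) g n + conv f (dmul g) n).
Proof.
move=> hf hg hf' hg'.
have b h r : nle 1 0 r h -> forall n, cmod (h n : R[i]) <= r.
  by move=> hh n; exact: nle_cmod hh.
apply/funext => n.
have h1 := has_zsum_lin 1 (conv_has n hf' (b _ _ hg)) (conv_has n hf (b _ _ hg')).
have h2 := has_zsum_lin n%:~R (conv_has n hf (b _ _ hg)) (has_zsum_zero (fun=> erefl)).
rewrite addr0 in h2; apply: has_zsum_unique h2 _.
move: h1; congr has_zsum; apply/funext => j.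
by rewrite /dmul rmorphB /=; ring.
Qed.

(** The cost of removing a factor e_1: [wtD_le] for n = (n + 1) + (-1) gives 2^j (w + 1) with w the
    weight at n + 1, and 1 <= w. *)
Lemma nle_shift1 j s f : nle p j s f -> nle p j (2 ^+ j.+1 * s) (fun n => f (n + 1)).
Proof.
move=> hf l ul.
have hw n : wt R j n <= 2 ^+ j.+1 * wt R j (n + 1).
  have := wtD_le R j (n + 1) (-1); rewrite addrK (@wt_neq0 _ _ (-1))// normrN1 expr1n => h.
  apply: le_trans h _; rewrite exprSr -mulrA ler_wpM2l ?exprn_ge0//.
  by have := wt_ge1 R j (n + 1); lra.
apply: (@le_trans _ _ (rnorm p l (fun n => 2 ^+ j.+1 * (cmod (f (n + 1)) * wt R j (n + 1))))).
  apply: rnorm_mono => // n; rewrite mulr_ge0 ?cmod_ge0 ?wt_ge0//=.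
  by rewrite mulrCA ler_wpM2l ?cmod_ge0.
rewrite rnormZ ?exprn_ge0//; last by move=> n; rewrite mulr_ge0 ?cmod_ge0 ?wt_ge0.
rewrite ler_wpM2l ?exprn_ge0//.
have := hf [seq n + 1 | n <- l]; rewrite map_inj_uniq; last by move=> i i' /addIr.
by move=> /(_ ul); rewrite /rnorm big_map.
Qed.

End Derivation.

(** * Descent through the weights *)

Section Descent.
Variables (R : realType) (p : R) (k : nat).
Hypothesis p_ge1 : 1 <= p.
Hypothesis emb : l1_embedded p k.
(** For p > 1 the inclusion in l^1 fails at weight 0; Young's inequality takes its place there, see
    [multiplier]. *)
Hypothesis emb_or0 : forall j, j = 0%N \/ l1_embedded p j.
Variable T : (int -> R[i]) -> (int -> R[i]).
Hypothesis T_mem : forall f, lpw p k.+1 f -> lpw p k.+1 (T f).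
Hypothesis T_lin : forall (c : R[i]) f g, lpw p k.+1 f -> lpw p k.+1 g ->
  T (fun n => c * f n + g n) = (fun n => c * T f n + T g n).
Hypothesis T_conv : forall f g, lpw p k.+1 f -> lpw p k.+1 g ->
  T (conv f g) = conv (T f) (T g).
Hypothesis T_surj : forall h, lpw p k.+1 h -> exists2 f, lpw p k.+1 f & T f = h.
Implicit Types (f g h : int -> R[i]) (s t : R) (l : seq int).

Lemma l1_embeddedS : l1_embedded p k.+1.
Proof.
have [C [C0 hC]] := emb; exists C; split; first exact: C0.
by move=> s f hf; exact: hC (nle_mono p_ge1 (leqnSn k) hf).
Qed.

Lemma lpw_delta j n : lpw p j (delta n).
Proof. by eexists; apply: nle_delta. Qed.

Lemma lpw_trunc j l f : uniq l -> lpw p j (trunc l f).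
Proof. exact: nle_trunc_ex. Qed.

Let T_l1 f : lpw p k.+1 f -> exists s, nle 1 0 s (T f).
Proof. by move=> hf; apply: (lpw_l1 l1_embeddedS); apply: T_mem. Qed.

Let lpw_dmul f : lpw p k.+1 f -> lpw p k (dmul f).
Proof. by move=> [s hs]; exists s; apply: nle_dmul. Qed.

Let DT_l1 f : lpw p k.+1 f -> exists s, nle 1 0 s (dmul (T f)).
Proof. by move=> /T_mem/lpw_dmul/(lpw_l1 emb). Qed.

(** By surjectivity e_0 = T e for some e, and then T e_0 = T e_0 * T e = T (e_0 * e) = T e. *)
Lemma T_unit : T (delta 0) = delta 0.
Proof.
have m0 := lpw_delta k.+1 0.
have [e me Te] := T_surj m0.
have [s1 l1] := T_l1 m0.
have d1 := nle_delta (lexx (1 : R)) 0 0.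
have bd n : cmod (T (delta 0) n) <= s1 by exact: nle_cmod l1.
have h1 : conv (T (delta 0)) (delta 0) = delta 0.
  rewrite -{2}Te -T_conv// -[RHS]Te; congr T; apply/funext => n.
  by rewrite conv_delta subr0.
rewrite -[RHS]h1 (conv_comm d1 bd); apply/funext => n.
by rewrite conv_delta subr0.
Qed.

(* [chi (T e_n)] is multiplicative in [n] and [chi (D (T e_n))] is a derivation
   along it, so their ratio is additive in [n]. *)
Lemma chi_dmul_T z : cmod z = 1 -> exists c, forall l g, uniq l ->
  chi z (dmul (T (trunc l g))) = c * chi z (T (dmul (trunc l g))).
Proof.
move=> z1.
have md n := lpw_delta k.+1 n.
pose a n := chi z (T (delta n)); pose b n := chi z (dmul (T (delta n))).
have dD m n : delta (m + n) = conv (delta m) (delta n) :> (int -> R[i]).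
  by apply/funext => j; rewrite conv_delta /delta subr_eq addrC.
have aD m n : a (m + n) = a m * a n.
  have [s1 h1] := T_l1 (md m); have [s2 h2] := T_l1 (md n).
  by rewrite /a dD T_conv// (chi_conv z1 h1 h2).
have bD m n : b (m + n) = b m * a n + a m * b n.
  have [s1 h1] := T_l1 (md m); have [s2 h2] := T_l1 (md n).
  have [t1 g1] := DT_l1 (md m); have [t2 g2] := DT_l1 (md n).
  rewrite /b dD T_conv// (dmul_conv h1 h2 g1 g2).
  rewrite (chi_lin _ z1 (young (lexx 1) g1 h2) (young (lexx 1) h1 g2)) mul1r.
  by rewrite (chi_conv z1 g1 h2) (chi_conv z1 h1 g2).
have a0 : a 0 = 1 by rewrite /a T_unit chi_delta expr0z.
have an0 n : a n != 0.
  apply/eqP => h; have := aD n (- n); rewrite subrr a0 h mul0r => /eqP.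
  by rewrite oner_eq0.
pose c n := b n / a n.
have cD m n : c (m + n) = c m + c n.
  by rewrite /c bD aD; field; rewrite !an0.
have c0 : c 0 = 0.
  by have := cD 0 0; rewrite addr0 -[LHS]addr0 => /addrI/esym.
have cnat (m : nat) : c m%:Z = m%:R * c 1.
  elim: m => [|m IH]; first by rewrite mul0r.
  by rewrite -addn1 PoszD cD IH natrD mulrDl mul1r.
have cint (m : int) : c m = m%:~R * c 1.
  case: m => m; first exact: cnat.
  rewrite NegzE rmorphN mulNr /=; apply/eqP; rewrite -addr_eq0 -[_%:~R]/(m.+1%:R) -cnat -cD.
  by rewrite addNr c0.
have bE n : b n = c 1 * (n%:~R * a n).
  by rewrite mulrCA mulrA -cint /c divfK.
(* Since D e_n = n e_n, [bE] is the claim for unit masses; the induction extends it by linearity. *)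
exists (c 1) => l g; rewrite dmul_trunc; elim: l => [_|n l IH /= /andP[nl ul]].
  have E (f : int -> R[i]) : trunc [::] f = (fun=> 0) by apply/funext.
  rewrite !E (T_zero p_ge1 T_lin).
  have -> : dmul (fun=> 0) = (fun=> 0) :> (int -> R[i]).
    by apply/funext => m; rewrite /dmul mulr0.
  have -> : chi z (fun=> 0) = 0.
    by apply/has_zsumE/has_zsum_zero => m; rewrite mul0r.
  by rewrite mulr0.
have m1 := lpw_trunc k.+1 g ul; have m2 := lpw_trunc k.+1 (dmul g) ul.
have [s1 h1] := T_l1 (md n); have [s2 h2] := T_l1 m2.
have [t1 g1] := DT_l1 (md n); have [t2 g2] := DT_l1 m1.
rewrite !trunc_cons// (T_lin _ (md n) m1) (T_lin _ (md n) m2) dmul_lin.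
rewrite (chi_lin _ z1 g1 g2) (chi_lin _ z1 h1 h2) IH// -/(a n) -/(b n) bE /dmul.
ring.
Qed.

(** Each side is sent by chi_z to c_z chi_z (T (D f)) chi_z (T (D g)), with [f] and [g] truncated,
    and the characters separate points. *)
Lemma T_dmul_exchange l f l' g : uniq l -> uniq l' ->
  conv (T (dmul (trunc l f))) (dmul (T (trunc l' g))) =
  conv (dmul (T (trunc l f))) (T (dmul (trunc l' g))).
Proof.
move=> ul ul'.
have [s1 h1] := T_l1 (lpw_trunc k.+1 (dmul f) ul).
have [s2 h2] := T_l1 (lpw_trunc k.+1 (dmul g) ul').
have [t1 g1] := DT_l1 (lpw_trunc k.+1 f ul).
have [t2 g2] := DT_l1 (lpw_trunc k.+1 g ul').
rewrite -!dmul_trunc in h1 h2.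
apply: (chi_inj (young (lexx 1) h1 g2) (young (lexx 1) g1 h2)) => z z1.
rewrite (chi_conv z1 h1 g2) (chi_conv z1 g1 h2).
have [c hc] := chi_dmul_T z1; rewrite !hc//; ring.
Qed.

(** Lets the fixed factors T (D psi_N) and r_N, known at weight [k], act at every lower weight: by
    Young's inequality at weight 0, by the algebra estimate [nle_conv] where l^1 contains the
    space. *)
Lemma multiplier j : (j <= k)%N -> exists C, 0 <= C /\ forall x h t s B,
  nle p k t x -> nle p j s h -> nle 1 0 B h -> nle p j (C * t * s) (conv x h).
Proof.
move=> jk; have [C [C0 hC]] := emb.
have [->|[C' [C'0 hC']]] := emb_or0 j.
  exists C; split; [exact: C0|move=> x h t s B hx hh _].
  exact: young (hC _ _ hx) hh.
exists (2 ^+ j * (C' + C)); split; first by rewrite mulr_ge0 ?exprn_ge0 ?addr_ge0.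
move=> x h t s B hx hh _.
have := nle_conv p_ge1 (nle_mono p_ge1 jk hx) hh (hC _ _ hx) (hC' _ _ hh).
by apply: nle_weaken; rewrite le_eqVlt; apply/orP; left; apply/eqP; ring.
Qed.

(** Finitely supported sequences lie in the domain of [T] whatever the weight [j] of the norm, so
    this makes sense for norms weaker than that of A. *)
Definition bounded_on_finite j := exists C, 0 <= C /\ forall l f s, uniq l ->
  nle p j s (trunc l f) -> nle p j (C * s) (T (trunc l f)).

Lemma descent_step j : (j <= k)%N -> bounded_on_finite j.+1 -> bounded_on_finite j.
Proof.
move=> jk [C [C0 hC]].
have [CT [CT0 hCT]] := T_bounded p_ge1 l1_embeddedS T_mem T_lin T_conv.
have [CM [CM0 hCM]] := multiplier jk.
have [psi mpsi Tpsi] := T_surj (lpw_delta k.+1 1).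
have P2 : 0 < 2 ^+ j.+1 :> R by rewrite exprn_gt0.
have [spsi hpsi] := mpsi.
(* A tail of psi of norm 1 / Q makes the coefficient of the absorbed term at most 1/2, see [small];
   the + 1 keeps [Q] positive. *)
pose Q := 2 * (2 ^+ j.+1 * CM * CT) + 1.
have Q0 : 0 < Q by rewrite /Q ltr_pwDr// !mulr_ge0// ltW.
have [N /(_ _ (leqnn N)) hN] := nle_tail p_ge1 hpsi (divr_gt0 ltr01 Q0).
pose psiN := trunc (win N) psi.
have uw := win_uniq N.
have mpsiN : lpw p k.+1 psiN by apply: lpw_trunc.
pose r n := delta 1 n - dmul (T psiN) n.
pose rho := CT * (1 / Q).
have hr : nle p k rho r.
  have := nle_dmul p_ge1 (hCT _ _ hN).
  rewrite (T_sub T_lin mpsi mpsiN) Tpsi -/rho.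
  apply: nle_le => // n; rewrite /r /dmul.
  have -> : n%:~R * (delta 1 n - T psiN n) = delta 1 n - n%:~R * T psiN n.
    rewrite mulrBr; congr (_ - _); rewrite /delta.
    by have [->|_] := eqVneq n 1; rewrite ?mulr1 ?mulr0.
  by [].
have small : 2 ^+ j.+1 * (CM * rho) <= 2^-1.
  rewrite /rho div1r !mulrA ler_pdivrMr// /Q; lra.
have mDpsi : lpw p k.+1 (dmul psiN) by rewrite /psiN dmul_trunc; apply: lpw_trunc.
have [X hX] : exists X, nle p k X (T (dmul psiN)).
  by have [X hX] := T_mem mDpsi; exists X; exact: (nle_mono p_ge1 (leqnSn k) hX).
have X0 := nle_ge0 hX.
have [s0 hs0] : exists s0, nle p j s0 (T (delta 0)).
  have [s0 hs0] := T_mem (lpw_delta k.+1 0); exists s0.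
  exact: (nle_mono p_ge1 (leqW jk) hs0).
have s00 := nle_ge0 hs0.
exists (2 * (2 ^+ j.+1 * (CM * X * C)) + s0); split.
  by rewrite addr_ge0// !mulr_ge0// ltW.
move=> l f s ul hf.
(* An antiderivative of [f] away from index 0, where division by zero gives g_0 = 0. *)
pose g n := f n / n%:~R.
pose h := T (dmul (trunc l g)).
have fE : trunc l f = (fun n => trunc l f 0 * delta 0 n + dmul (trunc l g) n).
  apply/funext => n; rewrite /dmul /trunc /delta /g.
  have [->|n0] := eqVneq n 0; first by rewrite mulr1 mul0r addr0.
  rewrite mulr0 add0r; case: ifP => _; last by rewrite mulr0.
  by rewrite mulrCA divff ?mulr1// intr_eq0.
(* Dividing by n makes up for exactly one power of the weight. *)
have hg : nle p j.+1 s (trunc l g).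
  apply: nle_le hf => // n; rewrite /trunc /g; case: ifP => _; last by rewrite cmod0 !mul0r.
  have [->|n0] := eqVneq n 0.
    by rewrite invr0 mulr0 cmod0 mul0r mulr_ge0 ?cmod_ge0 ?wt_ge0.
  rewrite wtS// cmodM cmodV cmod_int mulrA divfK//.
  by rewrite intr_eq0 normr_eq0.
have mg : lpw p k.+1 (trunc l g) by apply: lpw_trunc.
have mDg : lpw p k.+1 (dmul (trunc l g)) by rewrite dmul_trunc; apply: lpw_trunc.
have hTg : nle p j (C * s) (dmul (T (trunc l g))).
  by apply: nle_dmul => //; apply: hC.
have [B1 hB1] := DT_l1 mg; have [B2 hB2] := T_l1 mDg.
have [B3 hB3] := DT_l1 mpsiN.
(* The norm of [h] is finite because D g is finitely supported, so that [h] lies in A; without this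
   nothing could be absorbed. *)
have [m [hm mmin]] : exists m, nle p j m h /\ forall t, nle p j t h -> m <= t.
  have [t0 ht0] := T_mem mDg; apply: (nle_min p_ge1 (s := t0)).
  exact: (nle_mono p_ge1 (leqW jk) ht0).
have m0 := nle_ge0 hm.
(* The sequence is e_1 * h. Its part D (T psi_N) * h equals T (D psi_N) * D (T g), where [X] depends
   on psi_N only and [C] is the bound at weight j + 1. *)
have key : nle p j (CM * X * (C * s) + CM * rho * m) (fun n => h (n - 1)).
  have h1 := hCM _ _ _ _ _ hX hTg hB1.
  have h2 := hCM _ _ _ _ _ hr hm hB2.
  rewrite (T_dmul_exchange psi g uw ul) -/psiN -/h in h1.
  have bh n : cmod (h n) <= m by exact: nle_cmod hm.
  have [Br hBr] : exists B, nle 1 0 B r by apply: (lpw_l1 emb); exists rho.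
  have := conv_linl 1 hB3 hBr bh.
  have -> : (fun n => 1 * dmul (T psiN) n + r n) = delta 1.
    by apply/funext => n; rewrite mul1r /r addrC subrK.
  move=> E; have := nle_add p_ge1 h1 h2; congr nle; apply/funext => n.
  by rewrite -(conv_delta 1 h n) E mul1r.
have m_le : m <= 2 * (2 ^+ j.+1 * (CM * X * C)) * s.
  have h3 := nle_shift1 p_ge1 key.
  have {}h3 : nle p j (2 ^+ j.+1 * (CM * X * (C * s) + CM * rho * m)) h.
    by apply: nle_le h3 => // n; rewrite addrK.
  have := mmin _ h3; rewrite mulrDr.
  have := ler_wpM2r m0 small.
  have -> : 2 ^+ j.+1 * (CM * X * (C * s)) = 2 ^+ j.+1 * (CM * X * C) * s by ring.
  rewrite -!mulrA; move: (2 ^+ j.+1 * _) (2 ^+ j.+1 * _) => y y'; lra.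
(* The coefficient f_0, out of reach of D, contributes at most s times the norm of T e_0. *)
rewrite fE (T_lin _ (lpw_delta k.+1 0) mDg) mulrDl addrC.
apply: nle_weaken (nle_lin p_ge1 _ hs0 hm).
rewrite lerD// mulrC ler_wpM2l//; exact: nle_cmod hf.
Qed.

Lemma bounded_on_finite0 : bounded_on_finite 0.
Proof.
have h : bounded_on_finite k.+1.
  have [C [C0 hC]] := T_bounded p_ge1 l1_embeddedS T_mem T_lin T_conv.
  by exists C; split; [exact: C0|move=> l f s _; exact: hC].
have down i : (i <= k.+1)%N -> bounded_on_finite (k.+1 - i).
  elim: i => [|i IH] ik; first by rewrite subn0.
  apply: descent_step; first by lia.
  have -> : (k.+1 - i.+1).+1 = (k.+1 - i)%N by lia.
  exact: IH (ltnW ik).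
by have := down k.+1 (leqnn _); rewrite subnn.
Qed.

End Descent.

(** * Extension by density to l^p(Z) *)

Section Extension.
Variables (R : realType) (p : R) (k : nat).
Hypothesis p_ge1 : 1 <= p.
Implicit Types (f g h : int -> R[i]) (s t e : R) (T S : (int -> R[i]) -> (int -> R[i])).

(** Puts a difference of truncations in the form to which [bounded_on_finite] applies. *)
Lemma trunc_sub_supp i j f : let N := maxn i j in
  (fun n => trunc (win i) f n - trunc (win j) f n) =
  trunc (win N) (fun n => trunc (win i) f n - trunc (win j) f n).
Proof.
move=> N; apply/funext => n; rewrite {3}/trunc; case: ifPn => //.
by rewrite /trunc !mem_win leq_max negb_or => /andP[/negPf-> /negPf->]; rewrite subrr.
Qed.

Lemma ccvg_trunc f n : ccvg (fun i => trunc (win i) f n) (f n).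
Proof.
move=> e e0; have [N hN] := sub_win [:: n]; exists N => i Ni.
by rewrite /trunc (hN _ Ni _ (mem_head _ _)) subrr cmod0 ltW.
Qed.

Definition extends T S := forall f, lpw p 0 f -> forall e, 0 < e ->
  exists N, forall i, (N <= i)%N -> nle p 0 e (fun n => S f n - T (trunc (win i) f) n).

Lemma extension_exists T :
  (forall (c : R[i]) f g, lpw p k.+1 f -> lpw p k.+1 g ->
     T (fun n => c * f n + g n) = (fun n => c * T f n + T g n)) ->
  bounded_on_finite p T 0 -> exists S, extends T S.
Proof.
move=> T_lin [C [C0 hC]].
suff /choice[S hS] f : exists F, lpw p 0 f -> forall e, 0 < e ->
    exists N, forall i, (N <= i)%N -> nle p 0 e (fun n => F n - T (trunc (win i) f) n).
  by exists S => f; exact: hS.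
(* Outside l^p(Z) the value is arbitrary. *)
have [[s hs]|nf] := pselect (lpw p 0 f); last by exists (fun=> 0) => /nf.
have [e e0|F hF] := @nle_complete _ _ p_ge1 0 (fun i => T (trunc (win i) f)).
  have D0 : 0 < 2 * (C + 1) by rewrite mulr_gt0// ltr_pwDr.
  have [N hN] := nle_tail p_ge1 hs (divr_gt0 e0 D0).
  exists N => i j Ni Nj.
  have h1 := nle_sub p_ge1 (hN _ Nj) (hN _ Ni).
  pose g n := trunc (win i) f n - trunc (win j) f n.
  have {}h1 : nle p 0 (e / (2 * (C + 1)) + e / (2 * (C + 1))) g.
    apply: nle_le h1 => // n.
    have -> : f n - trunc (win j) f n - (f n - trunc (win i) f n) = g n by rewrite /g; ring.
    exact: lexx.
  rewrite /g trunc_sub_supp in h1.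
  have := hC _ _ _ (win_uniq _) h1; rewrite -trunc_sub_supp.
  have -> : T (fun n => trunc (win i) f n - trunc (win j) f n) =
            (fun n => T (trunc (win i) f) n - T (trunc (win j) f) n).
    apply: (T_sub T_lin); exact: lpw_trunc (win_uniq _).
  apply: nle_weaken.
  have -> : e / (2 * (C + 1)) + e / (2 * (C + 1)) = e / (C + 1).
    by field; rewrite gt_eqF// ltr_pwDr.
  by rewrite mulrCA ler_piMr ?(ltW e0)// ler_pdivrMr ?ltr_pwDr// mul1r lerDl.
by exists F => _; exact: hF.
Qed.

Section Properties.
Variables T S : (int -> R[i]) -> (int -> R[i]).
Hypothesis T_mem : forall f, lpw p k.+1 f -> lpw p k.+1 (T f).
Hypothesis T_lin : forall (c : R[i]) f g, lpw p k.+1 f -> lpw p k.+1 g ->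
  T (fun n => c * f n + g n) = (fun n => c * T f n + T g n).
Hypothesis T_bdd : exists C, 0 <= C /\ forall f s, nle p k.+1 s f -> nle p k.+1 (C * s) (T f).
Hypothesis T_fin : bounded_on_finite p T 0.
Hypothesis T_S : extends T S.

Lemma extends_ccvg f n : lpw p 0 f -> ccvg (fun i => T (trunc (win i) f) n) (S f n).
Proof.
move=> hf e e0; have [N hN] := T_S hf e0; exists N => i Ni.
by rewrite cmodBC; exact: nle_cmod (hN _ Ni).
Qed.

Lemma extension_bounded : exists C, 0 <= C /\
  forall f s, nle p 0 s f -> nle p 0 (C * s) (S f).
Proof.
have [C [C0 hC]] := T_fin; exists C; split; first exact: C0.
move=> f s hf; apply: (nle_lim p_ge1 (u := fun i => T (trunc (win i) f))).
  exists 0%N => i _; apply: hC; first exact: win_uniq.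
  exact: nle_trunc.
by move=> n; apply: extends_ccvg; exists s.
Qed.

Lemma extension_lin (c : R[i]) f g : lpw p 0 f -> lpw p 0 g ->
  S (fun n => c * f n + g n) = (fun n => c * S f n + S g n).
Proof.
move=> hf hg; apply/funext => n.
have h1 := extends_ccvg n (lpw_lin p_ge1 c hf hg).
have h2 := ccvgD c (extends_ccvg n hf) (extends_ccvg n hg).
apply: ccvg_unique h1 _; move: h2; congr ccvg; apply/funext => i.
have -> : trunc (win i) (fun n => c * f n + g n) =
    (fun n => c * trunc (win i) f n + trunc (win i) g n).
  by apply/funext => m; rewrite /trunc; case: ifP => // _; rewrite mulr0 addr0.
by rewrite (T_lin c (lpw_trunc p_ge1 _ f (win_uniq i)) (lpw_trunc p_ge1 _ g (win_uniq i))).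
Qed.

(** For f in A the images of the truncations also converge to [T f], by continuity of [T] on A; both
    limits are coefficientwise. *)
Lemma extension_eq f : lpw p k.+1 f -> S f = T f.
Proof.
move=> mf; have [s hs] := mf; have [C [C0 hC]] := T_bdd; apply/funext => n.
have f0 : lpw p 0 f by exists s; exact: nle_mono hs.
apply: ccvg_unique (extends_ccvg n f0) _ => e e0.
have C1 : 0 < C + 1 by rewrite ltr_pwDr.
have [N hN] := nle_tail p_ge1 hs (divr_gt0 e0 C1); exists N => i Ni.
have := nle_cmod p_ge1 n (hC _ _ (hN _ Ni)).
rewrite (T_sub T_lin mf (lpw_trunc p_ge1 _ _ (win_uniq _))) cmodBC => /le_trans; apply.
by rewrite mulrCA ler_piMr ?(ltW e0)// ler_pdivrMr// mul1r lerDl.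
Qed.

End Properties.

(** S' (S f) is the limit of S' (T f_i) = T' (T f_i) = f_i for the truncations f_i. As T f_i need
    not be finitely supported, agreement of S' with T' on all of A is used. *)
Lemma extension_cancel T T' S S' :
  (forall f, lpw p k.+1 f -> lpw p k.+1 (T f)) ->
  (forall f, lpw p k.+1 f -> T' (T f) = f) ->
  extends T S ->
  (forall f, lpw p k.+1 f -> S' f = T' f) ->
  (forall f, lpw p 0 f -> lpw p 0 (S f)) ->
  (forall (c : R[i]) f g, lpw p 0 f -> lpw p 0 g ->
     S' (fun n => c * f n + g n) = (fun n => c * S' f n + S' g n)) ->
  (exists C, 0 <= C /\ forall f s, nle p 0 s f -> nle p 0 (C * s) (S' f)) ->
  forall f, lpw p 0 f -> S' (S f) = f.
Proof.
move=> T_mem T'T T_S S'T' S_mem S'_lin [C [C0 hC]] f hf; apply/funext => n.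
apply: ccvg_unique (ccvg_trunc f n) => e e0.
have C1 : 0 < C + 1 by rewrite ltr_pwDr.
have [N hN] := T_S _ hf _ (divr_gt0 e0 C1); exists N => i Ni.
have mt : lpw p k.+1 (trunc (win i) f) by exact: lpw_trunc (win_uniq i).
have [s hs] := T_mem _ mt.
have mT0 : lpw p 0 (T (trunc (win i) f)) by exists s; exact: nle_mono hs.
have := nle_cmod p_ge1 n (hC _ _ (hN _ Ni)).
have -> : (fun n => S f n - T (trunc (win i) f) n) =
          (fun n => -1 * T (trunc (win i) f) n + S f n).
  by apply/funext => m; ring.
rewrite (S'_lin _ _ _ mT0 (S_mem _ hf)) S'T'; last exact: T_mem.
rewrite T'T// mulN1r addrC cmodBC => /le_trans; apply.
by rewrite mulrCA ler_piMr ?(ltW e0)// ler_pdivrMr// mul1r lerDl.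
Qed.

End Extension.

(** * Algebra isomorphisms, their inverses and the conclusion *)

Section Automorphism.
Variables (R : realType) (p : R) (k : nat).
Hypothesis p_ge1 : 1 <= p.
Hypothesis emb : l1_embedded p k.
Hypothesis emb_or0 : forall j, j = 0%N \/ l1_embedded p j.

Lemma iso_extension T : alg_iso_lpw p (k.+1%:Z%:~R) T -> exists S,
  [/\ forall f, lpw p k.+1 f -> S f = T f,
      extends p T S,
      forall (c : R[i]) f g, lpw p 0 f -> lpw p 0 g ->
        S (fun n => c * f n + g n) = (fun n => c * S f n + S g n) &
      exists C, 0 <= C /\ forall f s, nle p 0 s f -> nle p 0 (C * s) (S f)].
Proof.
move=> [h1 h2 h3 _ h5].
have P f : in_lpw p (k.+1%:Z%:~R) f <-> lpw p k.+1 f := in_lpwP p_ge1 k.+1 f.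
have T_mem f : lpw p k.+1 f -> lpw p k.+1 (T f) by move=> /P/h1/P.
have T_lin (c : R[i]) f g : lpw p k.+1 f -> lpw p k.+1 g ->
    T (fun n => c * f n + g n) = (fun n => c * T f n + T g n).
  by move=> /P hf /P hg; exact: h2.
have T_conv f g : lpw p k.+1 f -> lpw p k.+1 g -> T (conv f g) = conv (T f) (T g).
  by move=> /P hf /P hg; exact: h3.
have T_surj h : lpw p k.+1 h -> exists2 f, lpw p k.+1 f & T f = h.
  by move=> /P/h5[f /P hf Tf]; exists f.
have bdd := T_bounded p_ge1 (l1_embeddedS p_ge1 emb) T_mem T_lin T_conv.
have fin := bounded_on_finite0 p_ge1 emb emb_or0 T_mem T_lin T_conv T_surj.
have [S hS] := extension_exists p_ge1 T_lin fin.
exists S; split.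
- by move=> f hf; exact: (extension_eq p_ge1 T_lin bdd hS hf).
- exact: hS.
- by move=> c f g hf hg; exact: (extension_lin p_ge1 T_lin hS).
- exact: (extension_bounded p_ge1 fin hS).
Qed.

(** The inverse is again an algebra isomorphism, so it has an extension of its own, which will
    invert that of [T]. *)
Lemma iso_inverse T : alg_iso_lpw p (k.+1%:Z%:~R) T -> exists T',
  [/\ alg_iso_lpw p (k.+1%:Z%:~R) T',
      forall f, lpw p k.+1 f -> T' (T f) = f &
      forall f, lpw p k.+1 f -> T (T' f) = f].
Proof.
move=> [h1 h2 h3 h4 h5].
have P f : in_lpw p (k.+1%:Z%:~R) f <-> lpw p k.+1 f := in_lpwP p_ge1 k.+1 f.
have /choice[T' hT'] (h : int -> R[i]) : exists f, in_lpw p (k.+1%:Z%:~R) h ->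
    in_lpw p (k.+1%:Z%:~R) f /\ T f = h.
  have [/h5[f hf Tf]|nh] := pselect (in_lpw p (k.+1%:Z%:~R) h); first by exists f.
  by exists (fun=> 0) => /nh.
have T'_in f (hf : in_lpw p (k.+1%:Z%:~R) f) := (hT' f hf).1.
have TT' f (hf : in_lpw p (k.+1%:Z%:~R) f) := (hT' f hf).2.
have emb' := l1_embeddedS p_ge1 emb.
have lin_in (c : R[i]) f g : in_lpw p (k.+1%:Z%:~R) f -> in_lpw p (k.+1%:Z%:~R) g ->
    in_lpw p (k.+1%:Z%:~R) (fun n => c * f n + g n).
  by move=> /P hf /P hg; apply/P; exact: lpw_lin.
have conv_in f g : in_lpw p (k.+1%:Z%:~R) f -> in_lpw p (k.+1%:Z%:~R) g ->
    in_lpw p (k.+1%:Z%:~R) (conv f g).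
  by move=> /P hf /P hg; apply/P; exact: lpw_conv.
have T'T f : in_lpw p (k.+1%:Z%:~R) f -> T' (T f) = f.
  move=> hf; apply: h4 => //; first exact: T'_in (h1 _ hf).
  exact: TT' (h1 _ hf).
exists T'; split; last first.
- by move=> f /P; exact: TT'.
- by move=> f /P; exact: T'T.
split.
- exact: T'_in.
- move=> c f g hf hg.
  rewrite -[RHS]T'T; last exact: lin_in (T'_in _ hf) (T'_in _ hg).
  by rewrite (h2 _ _ _ (T'_in _ hf) (T'_in _ hg)) !TT'.
- move=> f g hf hg.
  rewrite -[RHS]T'T; last exact: conv_in (T'_in _ hf) (T'_in _ hg).
  by rewrite (h3 _ _ (T'_in _ hf) (T'_in _ hg)) !TT'.
- by move=> f g hf hg E; rewrite -(TT' _ hf) E TT'.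
- by move=> h hh; exists (T h); [exact: h1|exact: T'T].
Qed.

End Automorphism.

Theorem theorem3p1 (R : realType) (a : int) (p : R)
  (hp : 1 <= p)
  (hap : ((1 <= a)%R /\ p = 1) \/ ((2 <= a)%R /\ 1 < p))
  (T : (int -> R[i]) -> (int -> R[i]))
  (hT : alg_iso_lpw p (a%:~R) T) :
  exists S : (int -> R[i]) -> (int -> R[i]),
    (forall f, in_lpw p (a%:~R) f -> S f = T f) /\ lin_iso_lp p S.
Proof.
have [k aE] : exists k : nat, a = k.+1%:Z.
  by exists (absz a).-1; case: hap => -[]; lia.
rewrite aE in hap hT *; move: a aE => _ _.
(* For p > 1, a >= 2 leaves k >= 1, the positive weight that Hölder's inequality needs; for p = 1
   any [k] will do. *)
have emb : l1_embedded p k.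
  case: hap => -[ha hp1]; first by rewrite hp1; exact: l1_embedded_1.
  by apply: l1_embedded_gt1 => //; lia.
have emb_or0 j : j = 0%N \/ l1_embedded p j.
  case: hap => -[ha hp1]; first by right; rewrite hp1; exact: l1_embedded_1.
  by case: j => [|j]; [left|right; exact: l1_embedded_gt1].
have [T' [hT' T'T TT']] := iso_inverse hp emb hT.
have [S [ST extS S_lin S_bdd]] := iso_extension hp emb emb_or0 hT.
have [S' [ST' extS' S'_lin S'_bdd]] := iso_extension hp emb emb_or0 hT'.
have P f : in_lpw p (k.+1%:Z%:~R) f <-> lpw p k.+1 f := in_lpwP hp k.+1 f.
have P0 f : in_lp p f <-> lpw p 0 f := in_lpP hp f.
have S_mem f : lpw p 0 f -> lpw p 0 (S f).
  by have [C [_ hC]] := S_bdd => -[s /hC]; exists (C * s).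
have S'_mem f : lpw p 0 f -> lpw p 0 (S' f).
  by have [C [_ hC]] := S'_bdd => -[s /hC]; exists (C * s).
have T_mem f : lpw p k.+1 f -> lpw p k.+1 (T f).
  by case: hT => h _ _ _ _ /P/h/P.
have T'_mem f : lpw p k.+1 f -> lpw p k.+1 (T' f).
  by case: hT' => h _ _ _ _ /P/h/P.
have S'S := extension_cancel hp T_mem T'T extS ST' S_mem S'_lin S'_bdd.
have SS' := extension_cancel hp T'_mem TT' extS' ST S'_mem S_lin S_bdd.
exists S; split; first by move=> f /P; exact: ST.
split.
- by move=> f /P0/S_mem/P0.
- by move=> c f g /P0 hf /P0 hg; exact: S_lin.
- have [C [_ hC]] := S_bdd; exists C => f hf.
  by apply: lp_norm_le => //; apply: hC; exact: nle_lp_norm.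
- by move=> f g /P0 hf /P0 hg E; rewrite -(S'S _ hf) E S'S.
- split.
    by move=> h /P0 hh; exists (S' h); [apply/P0; exact: S'_mem|exact: SS'].
  have [C [_ hC]] := S'_bdd; exists C => f /P0 hf.
  apply: lp_norm_le => //; rewrite -{2}(S'S _ hf); apply: hC.
  by apply: nle_lp_norm => //; apply/P0; exact: S_mem.
Qed.
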